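(* (Lebesgue number lemma) The system $\mathsf{ACA}_0^\omega+\mathsf{QF\text{-}AC}^{0,1}$ proves: for every sequence $(O_n)_{n\in\mathbb{N}}$ of open sets with $[0,1]\subseteq\bigcup_{n\in\mathbb{N}}O_n$, there is $k\in\mathbb{N}$ such that for all $a,b\in[0,1]$ with $|a-b|<2^{-k}$ there is $n\in\mathbb{N}$ with $(a,b)\subseteq O_n$.
   Context: Framework: Kohlenbach's higher-order reverse mathematics; $\mathsf{RCA}_0^\omega$ is Kohlenbach's base theory (extensional primitive recursive arithmetic in all finite types with $\mathsf{QF\text{-}AC}^{1,0}$); $\mathsf{ACA}_0^\omega$ is $\mathsf{RCA}_0^\omega$ plus $(\exists^2)$: there is $E:\mathbb{N}^\mathbb{N}\to\{0,1\}$ with $(\forall f)[(\exists n)(f(n)=0)\leftrightarrow E(f)=0]$. $\mathsf{QF\text{-}AC}^{0,1}$: for all $Y^2$, if $(\forall n)(\exists f\in\mathbb{N}^\mathbb{N})(Y(f,n)=0)$ then there is $\Phi^{0\to1}$ with $(\forall n)(Y(\Phi(n),n)=0)$. An open set $U\subseteq\mathbb{R}$ is given by $h_U:\mathbb{R}\to\mathbb{R}$, with $x\in U$ meaning $h_U(x)>0$, such that $y\in U$ implies $(\exists N)(\forall z\in B(y,2^{-N}))(z\in U)$; a sequence of open sets is a sequence of representing functions. *)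

(* Defs.v *)
From Stdlib Require Import List.
Import ListNotations.

Set Implicit Arguments.
Unset Strict Implicit.
Unset Printing Implicit Defensive.

(** * The language of arithmetic in all finite types *)

Inductive ty : Type :=
| N : ty
| Arr : ty -> ty -> ty.

Declare Scope ty_scope.
Delimit Scope ty_scope with ty.
Bind Scope ty_scope with ty.
Notation "σ ⇒ τ" := (Arr σ τ) (at level 55, right associativity) : ty_scope.
Open Scope ty_scope.

(* The "type 1" of the literature: elements of Baire space. *)
Notation B := (N ⇒ N).

(* Variables are typed de Bruijn indices. *)
Inductive var : list ty -> ty -> Type :=
| vz : forall Γ σ, var (σ :: Γ) σ
| vs : forall Γ σ τ, var Γ τ -> var (σ :: Γ) τ.

Arguments vz {Γ σ}.
Arguments vs {Γ σ τ} _.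

(* [cK] and [cS] are the combinators usually called Π and Σ; [cRec] is the
   recursor of type-0 values, R_0. *)
Inductive cst : ty -> Type :=
| cZero : cst N
| cSucc : cst (N ⇒ N)
| cK : forall σ τ, cst (σ ⇒ τ ⇒ σ)
| cS : forall ρ σ τ, cst ((ρ ⇒ σ ⇒ τ) ⇒ (ρ ⇒ σ) ⇒ ρ ⇒ τ)
| cRec : cst ((N ⇒ N ⇒ N) ⇒ N ⇒ N ⇒ N).

Inductive tm (Γ : list ty) : ty -> Type :=
| Var : forall τ, var Γ τ -> tm Γ τ
| Cst : forall τ, cst τ -> tm Γ τ
| App : forall σ τ, tm Γ (σ ⇒ τ) -> tm Γ σ -> tm Γ τ.

Arguments Var {Γ τ} _.
Arguments Cst {Γ τ} _.
Arguments App {Γ σ τ} _ _.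

(* The only atomic formulas are equations of type 0. *)
Inductive fm : list ty -> Type :=
| Eq : forall Γ, tm Γ N -> tm Γ N -> fm Γ
| Bot : forall Γ, fm Γ
| Imp : forall Γ, fm Γ -> fm Γ -> fm Γ
| And : forall Γ, fm Γ -> fm Γ -> fm Γ
| Or : forall Γ, fm Γ -> fm Γ -> fm Γ
| All : forall Γ σ, fm (σ :: Γ) -> fm Γ
| Ex : forall Γ σ, fm (σ :: Γ) -> fm Γ.

Arguments Bot {Γ}.
Arguments All {Γ} σ _.
Arguments Ex {Γ} σ _.

Declare Scope fm_scope.
Delimit Scope fm_scope with fm.
Bind Scope fm_scope with fm.
Open Scope fm_scope.

Notation "s ⋅ t" := (App s t) (at level 40, left associativity) : fm_scope.
Notation "s ≐ t" := (Eq s t) (at level 70) : fm_scope.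
Notation "φ ⊓ ψ" := (And φ ψ) (at level 80, right associativity) : fm_scope.
Notation "φ ⊔ ψ" := (Or φ ψ) (at level 85, right associativity) : fm_scope.
Notation "φ ⊃ ψ" := (Imp φ ψ)
  (at level 99, right associativity, ψ at level 200) : fm_scope.
Notation "∀[ σ ] φ" := (All σ φ) (at level 200, φ at level 200) : fm_scope.
Notation "∃[ σ ] φ" := (Ex σ φ) (at level 200, φ at level 200) : fm_scope.

Definition Neg Γ (φ : fm Γ) : fm Γ := φ ⊃ Bot.
Definition Iff Γ (φ ψ : fm Γ) : fm Γ := (φ ⊃ ψ) ⊓ (ψ ⊃ φ).

Notation v0 := (Var vz).
Notation v1 := (Var (vs vz)).
Notation v2 := (Var (vs (vs vz))).
Notation v3 := (Var (vs (vs (vs vz)))).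
Notation v4 := (Var (vs (vs (vs (vs vz))))).
Notation v5 := (Var (vs (vs (vs (vs (vs vz)))))).

Fixpoint qf Γ (φ : fm Γ) : Prop :=
  match φ with
  | Eq _ _ | Bot => True
  | Imp φ ψ | And φ ψ | Or φ ψ => qf φ /\ qf ψ
  | All _ _ | Ex _ _ => False
  end.

(** * Renaming and substitution *)

Definition ren (Γ Δ : list ty) : Type := forall τ, var Γ τ -> var Δ τ.
Definition sub (Γ Δ : list ty) : Type := forall τ, var Γ τ -> tm Δ τ.

Fixpoint ren_tm Γ Δ (r : ren Γ Δ) τ (t : tm Γ τ) : tm Δ τ :=
  match t with
  | Var x => Var (r _ x)
  | Cst c => Cst c
  | App s t => App (ren_tm r s) (ren_tm r t)
  end.

Fixpoint sub_tm Γ Δ (s : sub Γ Δ) τ (t : tm Γ τ) : tm Δ τ :=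
  match t with
  | Var x => s _ x
  | Cst c => Cst c
  | App t u => App (sub_tm s t) (sub_tm s u)
  end.

Definition wk Γ σ τ (t : tm Γ τ) : tm (σ :: Γ) τ := ren_tm (fun _ x => vs x) t.
Arguments wk {Γ σ τ} t.

Definition scons Γ Δ σ (t : tm Δ σ) (s : sub Γ Δ) : sub (σ :: Γ) Δ :=
  fun τ x =>
    match x in var (σ' :: Γ') τ' return tm Δ σ' -> sub Γ' Δ -> tm Δ τ' with
    | vz => fun t _ => t
    | vs y => fun _ s => s _ y
    end t s.

Definition up Γ Δ (s : sub Γ Δ) σ : sub (σ :: Γ) (σ :: Δ) :=
  scons (Var vz) (fun τ x => wk (s τ x)).
Arguments up {Γ Δ} s {σ}.

Fixpoint sub_fm Γ (φ : fm Γ) : forall Δ, sub Γ Δ -> fm Δ :=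
  match φ with
  | Eq t u => fun _ s => Eq (sub_tm s t) (sub_tm s u)
  | Bot => fun _ _ => Bot
  | Imp φ ψ => fun _ s => Imp (sub_fm φ s) (sub_fm ψ s)
  | And φ ψ => fun _ s => And (sub_fm φ s) (sub_fm ψ s)
  | Or φ ψ => fun _ s => Or (sub_fm φ s) (sub_fm ψ s)
  | All σ φ => fun _ s => All σ (sub_fm φ (up s))
  | Ex σ φ => fun _ s => Ex σ (sub_fm φ (up s))
  end.

Definition wk_fm Γ σ (φ : fm Γ) : fm (σ :: Γ) := sub_fm φ (fun _ x => Var (vs x)).
Arguments wk_fm {Γ σ} φ.

Definition inst Γ σ (φ : fm (σ :: Γ)) (t : tm Γ σ) : fm Γ :=
  sub_fm φ (scons t (fun _ x => Var x)).

(** * Classical natural deduction *)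

(* The context [Γ] declares the free (eigen)variables; [T] gives the axioms,
   possibly with free variables. *)
Inductive prv (T : forall Γ, fm Γ -> Prop) :
    forall Γ, list (fm Γ) -> fm Γ -> Prop :=
| prv_ax Γ (H : list (fm Γ)) φ : T Γ φ -> prv T H φ
| prv_hyp Γ (H : list (fm Γ)) φ : In φ H -> prv T H φ
| prv_raa Γ (H : list (fm Γ)) φ : prv T (Neg φ :: H) Bot -> prv T H φ
| prv_impI Γ (H : list (fm Γ)) φ ψ : prv T (φ :: H) ψ -> prv T H (φ ⊃ ψ)
| prv_impE Γ (H : list (fm Γ)) φ ψ : prv T H (φ ⊃ ψ) -> prv T H φ -> prv T H ψ
| prv_andI Γ (H : list (fm Γ)) φ ψ : prv T H φ -> prv T H ψ -> prv T H (φ ⊓ ψ)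
| prv_andE1 Γ (H : list (fm Γ)) φ ψ : prv T H (φ ⊓ ψ) -> prv T H φ
| prv_andE2 Γ (H : list (fm Γ)) φ ψ : prv T H (φ ⊓ ψ) -> prv T H ψ
| prv_orI1 Γ (H : list (fm Γ)) φ ψ : prv T H φ -> prv T H (φ ⊔ ψ)
| prv_orI2 Γ (H : list (fm Γ)) φ ψ : prv T H ψ -> prv T H (φ ⊔ ψ)
| prv_orE Γ (H : list (fm Γ)) φ ψ χ :
    prv T H (φ ⊔ ψ) -> prv T (φ :: H) χ -> prv T (ψ :: H) χ -> prv T H χ
| prv_allI Γ (H : list (fm Γ)) σ (φ : fm (σ :: Γ)) :
    prv T (map wk_fm H) φ -> prv T H (∀[σ] φ)
| prv_allE Γ (H : list (fm Γ)) σ (φ : fm (σ :: Γ)) (t : tm Γ σ) :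
    prv T H (∀[σ] φ) -> prv T H (inst φ t)
| prv_exI Γ (H : list (fm Γ)) σ (φ : fm (σ :: Γ)) (t : tm Γ σ) :
    prv T H (inst φ t) -> prv T H (∃[σ] φ)
| prv_exE Γ (H : list (fm Γ)) σ (φ : fm (σ :: Γ)) ψ :
    prv T H (∃[σ] φ) -> prv T (φ :: map wk_fm H) (wk_fm ψ) ->
    prv T H ψ.

Definition proves (T : forall Γ, fm Γ -> Prop) (φ : fm []) : Prop := prv T [] φ.

(** * The axioms *)

Section Terms.
Context {Γ : list ty}.
Implicit Types m n : tm Γ N.

Definition zero : tm Γ N := Cst cZero.
Definition succ n : tm Γ N := Cst cSucc ⋅ n.
Definition one : tm Γ N := succ zero.
Definition two : tm Γ N := succ one.
Definition rec (f : tm Γ (N ⇒ N ⇒ N)) m n : tm Γ N := Cst cRec ⋅ f ⋅ m ⋅ n.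
End Terms.

(* Equality at higher types is a defined, pointwise notion. *)
Fixpoint eqt τ : forall Γ, tm Γ τ -> tm Γ τ -> fm Γ :=
  match τ with
  | N => fun Γ s t => s ≐ t
  | Arr σ τ => fun Γ s t => ∀[σ] eqt (wk s ⋅ v0) (wk t ⋅ v0)
  end.

(* E-PRA^ω together with QF-AC^{1,0}. *)
Inductive RCA0w : forall Γ, fm Γ -> Prop :=
| ax_refl Γ : RCA0w (Γ := Γ) (∀[N] v0 ≐ v0)
| ax_sym Γ : RCA0w (Γ := Γ) (∀[N] ∀[N] v1 ≐ v0 ⊃ v0 ≐ v1)
| ax_trans Γ : RCA0w (Γ := Γ) (∀[N] ∀[N] ∀[N] v2 ≐ v1 ⊃ v1 ≐ v0 ⊃ v2 ≐ v0)
| ax_succ_neq0 Γ : RCA0w (Γ := Γ) (∀[N] Neg (succ v0 ≐ zero))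
| ax_succ_inj Γ : RCA0w (Γ := Γ) (∀[N] ∀[N] succ v1 ≐ succ v0 ⊃ v1 ≐ v0)
| ax_K Γ σ τ : RCA0w (Γ := Γ) (∀[σ] ∀[τ] eqt (Cst (cK σ τ) ⋅ v1 ⋅ v0) v1)
| ax_S Γ ρ σ τ :
    RCA0w (Γ := Γ) (∀[ρ ⇒ σ ⇒ τ] ∀[ρ ⇒ σ] ∀[ρ]
      eqt (Cst (cS ρ σ τ) ⋅ v2 ⋅ v1 ⋅ v0) (v2 ⋅ v0 ⋅ (v1 ⋅ v0)))
| ax_rec0 Γ : RCA0w (Γ := Γ) (∀[N ⇒ N ⇒ N] ∀[N] rec v1 v0 zero ≐ v0)
| ax_recS Γ :
    RCA0w (Γ := Γ) (∀[N ⇒ N ⇒ N] ∀[N] ∀[N]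
      rec v2 v1 (succ v0) ≐ v2 ⋅ v0 ⋅ rec v2 v1 v0)
| ax_ext Γ ρ τ :
    RCA0w (Γ := Γ) (∀[ρ] ∀[ρ] ∀[ρ ⇒ τ] eqt v2 v1 ⊃ eqt (v0 ⋅ v2) (v0 ⋅ v1))
| ax_qfind Γ (φ : fm (N :: Γ)) :
    qf φ ->
    RCA0w (inst φ zero ⊓
           (∀[N] φ ⊃ sub_fm φ (scons (succ v0) (fun _ x => Var (vs x)))) ⊃
           ∀[N] φ)
| ax_qfac10 Γ :
    RCA0w (Γ := Γ) (∀[B ⇒ N ⇒ N]
      (∀[B] ∃[N] v2 ⋅ v1 ⋅ v0 ≐ zero) ⊃
      ∃[B ⇒ N] ∀[B] v2 ⋅ v0 ⋅ (v1 ⋅ v0) ≐ zero).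

Inductive ACA0w : forall Γ, fm Γ -> Prop :=
| ACA0w_base Γ (φ : fm Γ) : RCA0w φ -> ACA0w φ
| ax_exists2 Γ :
    ACA0w (Γ := Γ) (∃[B ⇒ N] ∀[B]
      (v1 ⋅ v0 ≐ zero ⊔ v1 ⋅ v0 ≐ one) ⊓
      Iff (∃[N] v1 ⋅ v0 ≐ zero) (v1 ⋅ v0 ≐ zero)).

Inductive ACA0w_QFAC01 : forall Γ, fm Γ -> Prop :=
| ACA0w_QFAC01_base Γ (φ : fm Γ) : ACA0w φ -> ACA0w_QFAC01 φ
| ax_qfac01 Γ :
    ACA0w_QFAC01 (Γ := Γ) (∀[B ⇒ N ⇒ N]
      (∀[N] ∃[B] v2 ⋅ v0 ⋅ v1 ≐ zero) ⊃
      ∃[N ⇒ B] ∀[N] v2 ⋅ (v1 ⋅ v0) ⋅ v0 ≐ zero).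

(** * Primitive recursive arithmetic on type 0 *)

(* Bracket abstraction: [lam t] is the combinatory term "λx. t", where [x] is
   the variable of index 0. *)
Fixpoint lam Γ σ τ (t : tm (σ :: Γ) τ) : tm Γ (σ ⇒ τ) :=
  match t with
  | Var x =>
      match x in var (σ' :: Γ') τ' return tm Γ' (σ' ⇒ τ') with
      | @vz Γ σ => Cst (cS σ (σ ⇒ σ) σ) ⋅ Cst (cK σ (σ ⇒ σ)) ⋅ Cst (cK σ σ)
      | vs y => Cst (cK _ _) ⋅ Var y
      end
  | Cst c => Cst (cK _ _) ⋅ Cst c
  | App s t => Cst (cS _ _ _) ⋅ lam s ⋅ lam t
  end.

Section Arithmetic.
Context {Γ : list ty}.
Implicit Types m n p q r : tm Γ N.

(* In [addN], [mulN] and [monus] the step function ignores the recursion index,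
   whence the combinator [cK]. *)
Definition addN m n : tm Γ N := rec (Cst (cK _ _) ⋅ Cst cSucc) m n.
Definition mulN m n : tm Γ N :=
  rec (Cst (cK _ _) ⋅ (Cst cRec ⋅ (Cst (cK _ _) ⋅ Cst cSucc) ⋅ m)) zero n.
Definition predN n : tm Γ N := rec (Cst (cK _ _)) zero n.
Definition monus m n : tm Γ N :=
  rec (Cst (cK _ _) ⋅ (Cst cRec ⋅ Cst (cK _ _) ⋅ zero)) m n.
End Arithmetic.

Section Codes.
Context {Γ : list ty}.
Implicit Types m n a b d p q r : tm Γ N.

Definition pow2 n : tm Γ N := rec (lam (lam (addN v0 v0))) one n.
Definition leN m n : fm Γ := monus m n ≐ zero.
Definition ltN m n : fm Γ := leN (succ m) n.

(* tri n = 0 + 1 + ... + n *)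
Definition tri n : tm Γ N := rec (lam (lam (addN v0 (succ v1)))) zero n.
End Codes.

Section Rationals.
Context {Γ : list ty}.
Implicit Types m n a b c d p q r : tm Γ N.

(* The Cantor pairing; [root p] is the largest w with tri w <= p, found by
   letting w advance at stage k + 1 exactly when tri (w + 1) <= k + 1. *)
Definition pairN m n : tm Γ N := addN (tri (addN m n)) n.
Definition root p : tm Γ N :=
  rec (lam (lam (addN v0 (monus one (monus (tri (succ v0)) (succ v1)))))) zero p.
Definition sndN p : tm Γ N := monus p (tri (root p)).
Definition fstN p : tm Γ N := monus (root p) (sndN p).

(* The code of the rational (a - b) / d, for d > 0; every number codes a
   rational. *)
Definition rat a b d : tm Γ N := pairN (pairN a b) (predN d).
Definition pos q : tm Γ N := fstN (fstN q).
Definition neg q : tm Γ N := sndN (fstN q).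
Definition den q : tm Γ N := succ (sndN q).

(* The code of c / 2^n. *)
Definition dyadic c n : tm Γ N := rat c zero (pow2 n).

Definition qadd q r : tm Γ N :=
  rat (addN (mulN (pos q) (den r)) (mulN (pos r) (den q)))
      (addN (mulN (neg q) (den r)) (mulN (neg r) (den q)))
      (mulN (den q) (den r)).
Definition qsub q r : tm Γ N :=
  rat (addN (mulN (pos q) (den r)) (mulN (neg r) (den q)))
      (addN (mulN (neg q) (den r)) (mulN (pos r) (den q)))
      (mulN (den q) (den r)).
Definition qabs q : tm Γ N :=
  rat (addN (monus (pos q) (neg q)) (monus (neg q) (pos q))) zero (den q).
Definition qlt q r : fm Γ :=
  ltN (addN (mulN (pos q) (den r)) (mulN (neg r) (den q)))
      (addN (mulN (pos r) (den q)) (mulN (neg q) (den r))).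
Definition qle q r : fm Γ :=
  leN (addN (mulN (pos q) (den r)) (mulN (neg r) (den q)))
      (addN (mulN (pos r) (den q)) (mulN (neg q) (den r))).
End Rationals.

(** * Real numbers: fast converging Cauchy sequences of rationals *)

Section Reals.
Context {Γ : list ty}.
Implicit Types x y : tm Γ B.

(* |x_n - x_{n+i}| < 2^{-n} *)
Definition isReal x : fm Γ :=
  ∀[N] ∀[N] qlt (qabs (qsub (wk (wk x) ⋅ v1) (wk (wk x) ⋅ addN v1 v0)))
                (dyadic one v1).

(* |x_n - y_n| <= 2^{-n+1} *)
Definition req x y : fm Γ :=
  ∀[N] qle (qabs (qsub (wk x ⋅ v0) (wk y ⋅ v0))) (dyadic two v0).

(* x_n + 2^{-n+1} < y_n for some n *)
Definition rlt x y : fm Γ :=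
  ∃[N] qlt (qadd (wk x ⋅ v0) (dyadic two v0)) (wk y ⋅ v0).

(* x_n <= y_n + 2^{-n+1} for all n *)
Definition rle x y : fm Γ :=
  ∀[N] qle (wk x ⋅ v0) (qadd (wk y ⋅ v0) (dyadic two v0)).

Definition rconst (q : tm Γ N) : tm Γ B := Cst (cK _ _) ⋅ q.
Definition rzero : tm Γ B := rconst (dyadic zero zero).
Definition rone : tm Γ B := rconst (dyadic one zero).
Definition rpow2neg (k : tm Γ N) : tm Γ B := rconst (dyadic one k).

(* The index shift keeps the difference fast converging. *)
Definition rsub x y : tm Γ B :=
  lam (qsub (wk x ⋅ succ v0) (wk y ⋅ succ v0)).
Definition rabs x : tm Γ B := lam (qabs (wk x ⋅ v0)).
End Reals.

Notation "∀ℝ φ" := (All B (Imp (isReal v0) φ))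
  (at level 200, φ at level 200) : fm_scope.

(** * Open sets *)

Section OpenSets.
Context {Γ : list ty}.
Implicit Types (x : tm Γ B) (h : tm Γ (B ⇒ B)).

(* h represents a function from ℝ to ℝ: it maps reals to reals and respects
   equality of reals. *)
Definition isRealFun h : fm Γ :=
  (∀ℝ isReal (wk h ⋅ v0)) ⊓
  (∀ℝ ∀ℝ req v1 v0 ⊃ req (wk (wk h) ⋅ v1) (wk (wk h) ⋅ v0)).

Definition mem x h : fm Γ := rlt rzero (h ⋅ x).

Definition inBall (z y : tm Γ B) (k : tm Γ N) : fm Γ :=
  rlt (rabs (rsub z y)) (rpow2neg k).

Definition in01 x : fm Γ := rle rzero x ⊓ rle x rone.
End OpenSets.

Definition isOpen Γ (h : tm Γ (B ⇒ B)) : fm Γ :=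
  isRealFun h ⊓
  (∀ℝ mem v0 (wk h) ⊃
     ∃[N] ∀ℝ inBall v0 v2 v1 ⊃ mem v0 (wk (wk (wk h)))).

(* Main.v *)
From HB Require Import structures.
From mathcomp Require Import all_boot all_order all_algebra.
From mathcomp Require Import ring lra.
From mathcomp.classical Require Import boolp.
From Stdlib Require Cantor Eqdep_dec.
From Stdlib Require Import List.
Require Import Defs.
Import ListNotations.

(** By Henkin's completeness theorem it suffices to verify the statement in an
    arbitrary model of the axioms, and after dividing by provable extensional
    equality the model is extensional with genuine equality.  Its type-0 part is a
    possibly nonstandard semiring, which embeds in an ordered field [F]; there the
    rational codes take values, and the formulas about reals become inequalities
    in [F].  With (∃²), induction and QF-AC^{0,1} hold in the model for all
    arithmetical formulas.

    Suppose no [k] is a Lebesgue number.  Then for every [k] there are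
    [c_k <= 2^k] and points [z_{k,n}] outside [O_n], all within [8 * 2^-k] of
    [c_k / 2^k]; two uses of choice give these as sequences.  The limit superior
    [x] of [c_k / 2^k] is a real of [0, 1], approximated up to [2^-n] by [d / 2^n]
    for the largest [d] with [d / 2^n <= c_k / 2^k] for infinitely many [k].  So
    [x] lies in some [O_n] together with a ball, and this ball contains some
    [z_{k,n}]. *)

Set Implicit Arguments.
Unset Strict Implicit.
Unset Printing Implicit Defensive.

(** * Substitution *)

(** Whatever is infinitary must therefore be stated by an arithmetical formula, to which induction
    and choice inside the model apply. Being a Lebesgue number quantifies over reals and is not such
    a formula. Its failure is used only externally, to produce objects; what is retained of them,
    the dyadic centers [c_k / 2^k] and points near them, is described arithmetically. Comparing
    dyadics is quantifier-free, so holding for infinitely many [k] is arithmetical, and the limit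
    superior becomes a choice of one number for each precision.

    The member of the cover that contains the limit is known only once the limit is formed. Hence
    points missing every [O_n] must be at hand beforehand, for all [k] and [n]. Since QF-AC^{0,1}
    yields one element of Baire space per number, the points for fixed [k] are chosen over [n],
    packed with [c_k] into one function, and such functions are then chosen over [k]. *)

Lemma dfunext (A : Type) (P : A -> Type) (f g : forall x, P x) :
  (forall x, f x = g x) -> f = g.
Proof. exact: functional_extensionality_dep. Qed.

(** Classical equality tests give uniqueness of identity proofs on every index type, which is what
    inverting typed terms and formulas needs. *)
Lemma inj_pairT (A : Type) (P : A -> Type) (a : A) (x y : P a) :
  existT P a x = existT P a y -> x = y.
Proof. exact: (Eqdep_dec.inj_pair2_eq_dec A (fun x y => pselect (x = y))). Qed.

(** The family [P] is arbitrary so that one case analysis serves environments of a structure,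
    assignments of closed terms and the naming of variables. *)
Definition vcase (P : ty -> Type) Γ σ (p : P σ) (f : forall τ, var Γ τ -> P τ) :
    forall τ, var (σ :: Γ) τ -> P τ :=
  fun τ x =>
    match x in var (σ' :: Γ') τ'
      return P σ' -> (forall τ, var Γ' τ -> P τ) -> P τ' with
    | vz _ _ => fun p _ => p
    | vs _ _ _ y => fun _ f => f _ y
    end p f.

Lemma var_consP Γ σ (P : forall τ, var (σ :: Γ) τ -> Prop) :
  P σ vz -> (forall τ y, P τ (vs y)) -> forall τ x, P τ x.
Proof.
move=> Pz Ps τ x.
exact: (match x in var (σ' :: Γ') τ' return
   forall (Q : forall τ, var (σ' :: Γ') τ -> Prop),
   Q σ' vz -> (forall τ y, Q τ (vs y)) -> Q τ' x with
   | vz _ _ => fun Q q _ => q | vs _ _ _ y => fun Q _ q => q _ y end P Pz Ps).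
Qed.

Lemma var_nilP (P : Type) τ : var [] τ -> P.
Proof. by move=> x; inversion x. Qed.

Lemma sub_ext Γ Δ (s s' : sub Γ Δ) : (forall τ x, s τ x = s' τ x) -> s = s'.
Proof. by move=> h; apply: dfunext => τ; apply: dfunext => x. Qed.

Lemma sub_tm_ren Γ Δ Θ (r : ren Γ Δ) (s : sub Δ Θ) τ (t : tm Γ τ) :
  sub_tm s (ren_tm r t) = sub_tm (fun τ x => s τ (r τ x)) t.
Proof. by elim: t => //= ? ? t -> u ->. Qed.

Lemma ren_tm_sub Γ Δ (r : ren Γ Δ) τ (t : tm Γ τ) :
  ren_tm r t = sub_tm (fun τ x => Var (r τ x)) t.
Proof. by elim: t => //= ? ? t -> u ->. Qed.

Lemma sub_tm_comp Γ Δ Θ (s : sub Γ Δ) (s' : sub Δ Θ) τ (t : tm Γ τ) :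
  sub_tm s' (sub_tm s t) = sub_tm (fun τ x => sub_tm s' (s τ x)) t.
Proof. by elim: t => //= ? ? t -> u ->. Qed.

Lemma sub_tm_Var Γ τ (t : tm Γ τ) : sub_tm (fun _ x => Var x) t = t.
Proof. by elim: t => //= ? ? t -> u ->. Qed.

Lemma sub_tm_wk Γ Δ σ (s : sub (σ :: Γ) Δ) τ (t : tm Γ τ) :
  sub_tm s (wk t) = sub_tm (fun τ x => s τ (vs x)) t.
Proof. exact: sub_tm_ren. Qed.

Lemma wk_sub_tm Γ Δ σ (s : sub Γ Δ) τ (t : tm Γ τ) :
  wk (σ := σ) (sub_tm s t) = sub_tm (fun τ x => wk (s τ x)) t.
Proof. by elim: t => //= ? ? t <- u <-. Qed.

Lemma sub_tm_up_wk Γ Δ σ (s : sub Γ Δ) τ (t : tm Γ τ) :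
  sub_tm (up s) (wk t) = wk (σ := σ) (sub_tm s t).
Proof. by rewrite sub_tm_wk wk_sub_tm. Qed.

Lemma up_comp Γ Δ Θ σ (s : sub Γ Δ) (s' : sub Δ Θ) :
  (fun τ x => sub_tm (up s') (up (σ := σ) s τ x)) =
  up (fun τ x => sub_tm s' (s τ x)).
Proof.
apply: sub_ext; apply: var_consP => // τ y /=.
exact: sub_tm_up_wk.
Qed.

Lemma up_Var Γ σ : up (fun τ (x : var Γ τ) => Var x) = fun τ (x : var (σ :: Γ) τ) => Var x.
Proof. by apply: sub_ext; apply: var_consP. Qed.

Lemma sub_fm_comp Γ (φ : fm Γ) Δ Θ (s : sub Γ Δ) (s' : sub Δ Θ) :
  sub_fm (sub_fm φ s) s' = sub_fm φ (fun τ x => sub_tm s' (s τ x)).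
Proof.
elim: φ Δ Θ s s' => {Γ} /=.
- by move=> Γ t u Δ Θ s s'; rewrite !sub_tm_comp.
- by [].
- by move=> Γ φ IH ψ IH' Δ Θ s s'; rewrite IH IH'.
- by move=> Γ φ IH ψ IH' Δ Θ s s'; rewrite IH IH'.
- by move=> Γ φ IH ψ IH' Δ Θ s s'; rewrite IH IH'.
- by move=> Γ σ φ IH Δ Θ s s'; rewrite IH up_comp.
- by move=> Γ σ φ IH Δ Θ s s'; rewrite IH up_comp.
Qed.

Lemma sub_fm_Var Γ (φ : fm Γ) : sub_fm φ (fun _ x => Var x) = φ.
Proof.
elim: φ => {Γ} //=.
- by move=> Γ t u; rewrite !sub_tm_Var.
- by move=> Γ φ -> ψ ->.
- by move=> Γ φ -> ψ ->.
- by move=> Γ φ -> ψ ->.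
- by move=> Γ σ φ IH; rewrite up_Var IH.
- by move=> Γ σ φ IH; rewrite up_Var IH.
Qed.

Lemma scons_eta Γ Δ σ (t : tm Δ σ) (s : sub Γ Δ) (s' : sub (σ :: Γ) Δ) :
  s' σ vz = t -> (forall τ x, s' τ (vs x) = s τ x) -> s' = scons t s.
Proof. by move=> h0 h; apply: sub_ext; apply: var_consP. Qed.

Lemma inst_up Γ Δ σ (φ : fm (σ :: Γ)) (s : sub Γ Δ) (t : tm Δ σ) :
  inst (sub_fm φ (up s)) t = sub_fm φ (scons t s).
Proof.
rewrite /inst sub_fm_comp; congr sub_fm; apply: scons_eta => // τ x /=.
by rewrite sub_tm_wk /= sub_tm_Var.
Qed.

Lemma sub_inst Γ Δ σ (φ : fm (σ :: Γ)) (t : tm Γ σ) (s : sub Γ Δ) :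
  sub_fm (inst φ t) s = inst (sub_fm φ (up s)) (sub_tm s t).
Proof.
rewrite inst_up /inst sub_fm_comp; congr sub_fm.
exact: scons_eta.
Qed.

Lemma sub_wk_fm Γ Δ σ (φ : fm Γ) (s : sub Γ Δ) :
  sub_fm (wk_fm φ) (up s) = wk_fm (σ := σ) (sub_fm φ s).
Proof.
rewrite /wk_fm !sub_fm_comp; congr sub_fm; apply: sub_ext => τ x /=.
exact: ren_tm_sub.
Qed.

Lemma wk_fm_sub Γ Δ σ (φ : fm Γ) (s : sub Γ Δ) :
  wk_fm (σ := σ) (sub_fm φ s) = sub_fm φ (fun τ x => wk (s τ x)).
Proof.
rewrite /wk_fm sub_fm_comp; congr sub_fm; apply: sub_ext => τ x.
by rewrite /wk ren_tm_sub.
Qed.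

(** * Weakening, substitution and derived rules of the calculus *)

Section Deduction.
Variable T : forall Γ, fm Γ -> Prop.
Hypothesis T_sub : forall Γ Δ (φ : fm Γ) (s : sub Γ Δ), T φ -> T (sub_fm φ s).

Lemma incl_cons2 A (x : A) s s' : incl s s' -> incl (x :: s) (x :: s').
Proof. by move=> h y [->|/h]; [left|right]. Qed.

Lemma prv_mono Γ (H H' : list (fm Γ)) φ : incl H H' -> prv T H φ -> prv T H' φ.
Proof.
move=> sHH d; elim: d H' sHH => {Γ H φ}.
- by move=> Γ H φ h H' _; apply: prv_ax.
- by move=> Γ H φ h H' s; apply: prv_hyp; apply: s.
- by move=> Γ H φ _ IH H' s; apply/prv_raa/IH/incl_cons2.
- by move=> Γ H φ ψ _ IH H' s; apply/prv_impI/IH/incl_cons2.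
- by move=> Γ H φ ψ _ IH _ IH' H' s; apply: prv_impE (IH _ s) (IH' _ s).
- by move=> Γ H φ ψ _ IH _ IH' H' s; apply: prv_andI (IH _ s) (IH' _ s).
- by move=> Γ H φ ψ _ IH H' s; apply: prv_andE1 (IH _ s).
- by move=> Γ H φ ψ _ IH H' s; apply: prv_andE2 (IH _ s).
- by move=> Γ H φ ψ _ IH H' s; apply: prv_orI1 (IH _ s).
- by move=> Γ H φ ψ _ IH H' s; apply: prv_orI2 (IH _ s).
- move=> Γ H φ ψ χ _ IH _ IH1 _ IH2 H' s; apply: prv_orE (IH _ s) _ _.
    exact/IH1/incl_cons2.
  exact/IH2/incl_cons2.
- by move=> Γ H σ φ _ IH H' s; apply/prv_allI/IH/incl_map.
- by move=> Γ H σ φ t _ IH H' s; apply/prv_allE/IH.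
- by move=> Γ H σ φ t _ IH H' s; apply/prv_exI/IH.
- move=> Γ H σ φ ψ _ IH _ IH' H' s; apply: prv_exE (IH _ s) _.
  exact/IH'/incl_cons2/incl_map.
Qed.

Lemma map_wk_sub Γ Δ σ (H : list (fm Γ)) (s : sub Γ Δ) :
  map (fun φ => sub_fm φ (up s)) (map (wk_fm (σ := σ)) H) =
  map wk_fm (map (fun φ => sub_fm φ s) H).
Proof. by rewrite !map_map; apply: map_ext => φ; rewrite sub_wk_fm. Qed.

(** The contexts of the Henkin construction grow, and a proof passes from one stage to the next by
    weakening, which is a substitution. *)
Lemma prv_sub Γ (H : list (fm Γ)) φ : prv T H φ ->
  forall Δ (s : sub Γ Δ), prv T (map (fun ψ => sub_fm ψ s) H) (sub_fm φ s).
Proof.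
elim=> {Γ H φ} /=.
- by move=> Γ H φ h Δ s; apply/prv_ax/T_sub.
- by move=> Γ H φ h Δ s; apply: prv_hyp; exact: (in_map (fun ψ => sub_fm ψ s)).
- by move=> Γ H φ _ IH Δ s; apply/prv_raa/IH.
- by move=> Γ H φ ψ _ IH Δ s; apply/prv_impI/IH.
- by move=> Γ H φ ψ _ IH _ IH' Δ s; apply: prv_impE (IH _ s) (IH' _ s).
- by move=> Γ H φ ψ _ IH _ IH' Δ s; apply: prv_andI (IH _ s) (IH' _ s).
- by move=> Γ H φ ψ _ IH Δ s; apply: prv_andE1 (IH _ s).
- by move=> Γ H φ ψ _ IH Δ s; apply: prv_andE2 (IH _ s).
- by move=> Γ H φ ψ _ IH Δ s; apply: prv_orI1 (IH _ s).
- by move=> Γ H φ ψ _ IH Δ s; apply: prv_orI2 (IH _ s).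
- by move=> Γ H φ ψ χ _ IH _ IH1 _ IH2 Δ s; apply: prv_orE (IH _ s) (IH1 _ s) (IH2 _ s).
- by move=> Γ H σ φ _ IH Δ s; apply: prv_allI; rewrite -map_wk_sub; apply: IH.
- by move=> Γ H σ φ t _ IH Δ s; rewrite sub_inst; apply/prv_allE/IH.
- by move=> Γ H σ φ t _ IH Δ s; apply: prv_exI (sub_tm s t) _; rewrite -sub_inst.
- move=> Γ H σ φ ψ _ IH _ IH' Δ s; apply: prv_exE (IH _ s) _.
  by rewrite -map_wk_sub -sub_wk_fm; apply: IH'.
Qed.

Lemma prv_wk Γ σ (H : list (fm Γ)) φ :
  prv T H φ -> prv T (map (wk_fm (σ := σ)) H) (wk_fm φ).
Proof. by move=> d; apply: prv_sub d _ _. Qed.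

Lemma prv_absurd Γ (H : list (fm Γ)) φ : prv T H Bot -> prv T H φ.
Proof. by move=> d; apply/prv_raa/(prv_mono _ d) => x; right. Qed.

(** The Henkin construction provides witnesses for existential formulas only; a universal formula
    that fails gets its counterexample through this classical law. *)
Lemma prv_all_of_not_ex_not Γ (H : list (fm Γ)) σ (φ : fm (σ :: Γ)) :
  prv T H (Neg (∃[σ] Neg φ)) -> prv T H (∀[σ] φ).
Proof.
move=> d; apply/prv_allI/prv_raa.
apply: prv_impE (prv_mono _ (prv_wk σ d)) _; first by move=> x; right.
apply: (prv_exI (t := Var vz)).
rewrite [inst _ _](_ : _ = Neg φ); first by apply: prv_hyp; left.
rewrite -[RHS]sub_fm_Var /inst /= sub_fm_comp; congr (_ ⊃ _); congr sub_fm.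
by apply: sub_ext; apply: var_consP.
Qed.

End Deduction.

(** * Countability of the syntax *)

Import GenTree.

Fixpoint ty_code (σ : ty) : tree nat :=
  match σ with
  | N => Leaf 0
  | Arr σ τ => Node 0 [ty_code σ; ty_code τ]
  end.

Lemma ty_code_inj : injective ty_code.
Proof.
elim=> [|σ IH τ IH'] [|σ' τ'] //= [].
by move=> /IH -> /IH' ->.
Qed.

Fixpoint var_code Γ τ (x : var Γ τ) : nat :=
  match x with
  | vz _ _ => 0
  | vs _ _ _ y => (var_code y).+1
  end.

(** The codes of variables and applications omit types. Comparing dependent pairs lets the equality
    of codes recover them, in particular the argument type hidden in an application. *)
Lemma var_code_inj Γ τ (x : var Γ τ) τ' (x' : var Γ τ') :
  var_code x = var_code x' -> existT (var Γ) τ x = existT _ τ' x'.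
Proof.
elim: x τ' x' => {Γ τ} [Γ σ|Γ σ τ x IH]; apply: var_consP => //= τ' y [] /IH e.
exact: (f_equal (fun p => existT (var (σ :: Γ)) _ (vs (projT2 p))) e).
Qed.

Definition cst_code τ (c : cst τ) : tree nat :=
  match c with
  | cZero => Node 0 []
  | cSucc => Node 1 []
  | cK σ τ => Node 2 [ty_code σ; ty_code τ]
  | cS ρ σ τ => Node 3 [ty_code ρ; ty_code σ; ty_code τ]
  | cRec => Node 4 []
  end.

Lemma cst_code_inj τ (c : cst τ) τ' (c' : cst τ') :
  cst_code c = cst_code c' -> existT cst τ c = existT _ τ' c'.
Proof.
case: c => [||σ1 σ2|σ1 σ2 σ3|]; case: c' => [||τ1 τ2|τ1 τ2 τ3|] //= [].
  by move=> /ty_code_inj -> /ty_code_inj ->.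
by move=> /ty_code_inj -> /ty_code_inj -> /ty_code_inj ->.
Qed.

Fixpoint tm_code Γ τ (t : tm Γ τ) : tree nat :=
  match t with
  | Var _ x => Leaf (var_code x)
  | Cst _ c => Node 0 [cst_code c]
  | App _ _ t u => Node 1 [tm_code t; tm_code u]
  end.

Lemma tm_code_inj Γ τ (t : tm Γ τ) τ' (t' : tm Γ τ') :
  tm_code t = tm_code t' -> existT (tm Γ) τ t = existT _ τ' t'.
Proof.
elim: t τ' t' => {τ} [τ x|τ c|σ τ t IHt u IHu] τ' [τ'' x'|τ'' c'|σ' τ'' t' u'] //= [].
- move=> /var_code_inj e.
  exact: (f_equal (fun p => existT (tm Γ) _ (Var (projT2 p))) e).
- move=> /cst_code_inj e.
  exact: (f_equal (fun p => existT (tm Γ) _ (Cst (projT2 p))) e).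
- move=> /IHt e /IHu e'; have [e1 e2] := f_equal (@projT1 _ _) e; subst σ' τ''.
  by rewrite (inj_pairT e) (inj_pairT e').
Qed.

Fixpoint fm_code Γ (φ : fm Γ) : tree nat :=
  match φ with
  | Eq _ t u => Node 0 [tm_code t; tm_code u]
  | Bot _ => Node 1 []
  | Imp _ φ ψ => Node 2 [fm_code φ; fm_code ψ]
  | And _ φ ψ => Node 3 [fm_code φ; fm_code ψ]
  | Or _ φ ψ => Node 4 [fm_code φ; fm_code ψ]
  | All _ σ φ => Node 5 [ty_code σ; fm_code φ]
  | Ex _ σ φ => Node 6 [ty_code σ; fm_code φ]
  end.

Lemma fm_code_inj Γ : injective (@fm_code Γ).
Proof.
move=> φ; elim: φ => {Γ}.
- move=> Γ t u ψ; move: t u; case: ψ => //= Γ' t' u' t u [].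
  by move=> /tm_code_inj e /tm_code_inj e'; rewrite (inj_pairT e) (inj_pairT e').
- by move=> Γ; case.
- move=> Γ φ IH φ' IH' ψ; move: φ IH φ' IH'; case: ψ => //= Γ' ψ ψ' φ IH φ' IH' [].
  by move=> /IH -> /IH' ->.
- move=> Γ φ IH φ' IH' ψ; move: φ IH φ' IH'; case: ψ => //= Γ' ψ ψ' φ IH φ' IH' [].
  by move=> /IH -> /IH' ->.
- move=> Γ φ IH φ' IH' ψ; move: φ IH φ' IH'; case: ψ => //= Γ' ψ ψ' φ IH φ' IH' [].
  by move=> /IH -> /IH' ->.
- move=> Γ σ φ IH ψ; move: φ IH; case: ψ => //= Γ' σ' ψ φ IH [].
  by move=> /ty_code_inj e; subst σ'; move=> /IH ->.
- move=> Γ σ φ IH ψ; move: φ IH; case: ψ => //= Γ' σ' ψ φ IH [].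
  by move=> /ty_code_inj e; subst σ'; move=> /IH ->.
Qed.

(** A left inverse of the injective coding by countable trees; numbers that code no formula are sent
    to [Bot]. *)
Lemma fm_enum_ex Γ : exists e : nat -> fm Γ, forall φ, exists j, e j = φ.
Proof.
have /choice[e eP] (n : nat) : exists φ : fm Γ,
    forall ψ, pickle (fm_code ψ) = n -> ψ = φ.
  have [[ψ <-]|h] := pselect (exists ψ : fm Γ, pickle (fm_code ψ) = n).
    by exists ψ => χ /(pcan_inj pickleK)/fm_code_inj.
  by exists Bot => ψ eψ; case: h; exists ψ.
by exists e => φ; exists (pickle (fm_code φ)); rewrite -(eP _ φ).
Qed.

Definition fm_enum Γ : nat -> fm Γ := sval (cid (fm_enum_ex Γ)).

Lemma fm_enumP Γ (φ : fm Γ) : exists j, fm_enum Γ j = φ.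
Proof. exact: (svalP (cid (fm_enum_ex Γ))). Qed.

(** * Structures and satisfaction *)

Record structure := Structure {
  dom : ty -> Type;
  ap : forall σ τ, dom (σ ⇒ τ) -> dom σ -> dom τ;
  icst : forall τ, cst τ -> dom τ;
  ieq : dom N -> dom N -> Prop }.

Definition env (M : structure) Γ := forall τ, var Γ τ -> dom M τ.

Definition enil M : env M [] := fun τ x => var_nilP (dom M τ) x.
Definition econs M Γ σ (a : dom M σ) (ρ : env M Γ) : env M (σ :: Γ) := vcase a ρ.

Fixpoint eval M Γ τ (t : tm Γ τ) (ρ : env M Γ) : dom M τ :=
  match t with
  | Var _ x => ρ _ x
  | Cst _ c => icst M c
  | App _ _ t u => ap (eval t ρ) (eval u ρ)
  end.

Fixpoint sat M Γ (φ : fm Γ) : env M Γ -> Prop :=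
  match φ with
  | Eq _ t u => fun ρ => ieq (eval t ρ) (eval u ρ)
  | Bot _ => fun _ => False
  | Imp _ φ ψ => fun ρ => sat φ ρ -> sat ψ ρ
  | And _ φ ψ => fun ρ => sat φ ρ /\ sat ψ ρ
  | Or _ φ ψ => fun ρ => sat φ ρ \/ sat ψ ρ
  | All _ σ φ => fun ρ => forall a : dom M σ, sat φ (econs a ρ)
  | Ex _ σ φ => fun ρ => exists a : dom M σ, sat φ (econs a ρ)
  end.

Definition models (M : structure) (T : forall Γ, fm Γ -> Prop) : Prop :=
  forall Γ (φ : fm Γ) (ρ : env M Γ), T Γ φ -> sat φ ρ.

Lemma env_ext M Γ (ρ ρ' : env M Γ) : (forall τ x, ρ τ x = ρ' τ x) -> ρ = ρ'.
Proof. by move=> h; apply: dfunext => τ; apply: dfunext => x. Qed.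

Lemma env_nil M (ρ : env M []) : ρ = enil M.
Proof. by apply: env_ext => τ x; apply: var_nilP x. Qed.

(** * Henkin completeness *)

Section Completeness.
Variable T : forall Γ, fm Γ -> Prop.
Hypothesis T_sub : forall Γ Δ (φ : fm Γ) (s : sub Γ Δ), T φ -> T (sub_fm φ s).
Variable φ0 : fm [].
Hypothesis φ0_unprovable : ~ prv T [] φ0.

Definition consistent Γ (H : list (fm Γ)) : Prop := ~ prv T H Bot.

(* [agenda i j] is the j-th formula over the context of stage i, weakened to the
   current context. *)
Record stage := Stage {
  ctx : list ty;
  hyps : list (fm ctx);
  agenda : nat -> nat -> fm ctx }.

Definition decide Γ (H : list (fm Γ)) (φ : fm Γ) : fm Γ :=
  if pselect (consistent (φ :: H)) then φ else Neg φ.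

(** A formula that is not existential adds a dummy variable of type [N], so that every step extends
    the context by exactly one variable and the step number can serve as its name. *)
Definition witness Γ (φ : fm Γ) : {σ & list (fm (σ :: Γ))} :=
  match φ with
  | Ex Γ σ ψ => existT (fun σ => list (fm (σ :: Γ))) σ [ψ]
  | φ => existT (fun σ => list (fm (σ :: _))) N []
  end.

Definition current (S : stage) (m : nat) : fm (ctx S) :=
  let: (i, j) := Cantor.of_nat m in decide (hyps S) (agenda S i j).

Definition next (m : nat) (S : stage) : stage :=
  let φ := current S m in
  {| ctx := projT1 (witness φ) :: ctx S;
     hyps := app (projT2 (witness φ)) (map wk_fm (φ :: hyps S));
     agenda i j := if i == m.+1 then fm_enum _ j else wk_fm (agenda S i j) |}.

Fixpoint chain (m : nat) : stage :=
  match m with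
  | 0 => {| ctx := []; hyps := [Neg φ0]; agenda _ j := fm_enum [] j |}
  | m.+1 => next m (chain m)
  end.

Lemma decide_consistent Γ (H : list (fm Γ)) φ :
  consistent H -> consistent (decide H φ :: H).
Proof.
rewrite /decide => cH; case: pselect => //= h d; apply: h => d'; apply: cH.
exact: prv_impE (prv_impI d) (prv_impI d').
Qed.

Lemma witness_consistent Γ (H : list (fm Γ)) φ :
  consistent (φ :: H) -> consistent (app (projT2 (witness φ)) (map wk_fm (φ :: H))).
Proof.
(* A dummy variable of type [N] preserves consistency because [zero] can be substituted for it. *)
have fresh Δ (K : list (fm Δ)) : consistent K -> consistent (map (wk_fm (σ := N)) K).
  by move=> c d; apply: c; apply: (@prv_allE T _ _ N Bot zero); apply: prv_allI.
move: H; case: φ; try by move=> *; apply: fresh.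
move=> Δ σ ψ H c d; apply: c; apply: (@prv_exE T Δ _ σ ψ Bot _ d).
by apply: prv_hyp; left.
Qed.

Lemma chain_consistent m : consistent (hyps (chain m)).
Proof.
elim: m => [|m IH]; first by move=> d; apply: φ0_unprovable; apply: prv_raa.
apply: witness_consistent; rewrite /current; case: Cantor.of_nat => i j.
exact: decide_consistent.
Qed.

(** * Closed terms over all Henkin constants *)

Definition newty (m : nat) : ty := projT1 (witness (current (chain m) m)).

(** De Bruijn indices shift whenever the context grows; the step at which a variable was added is
    its stable identity. The terms [ctm] over these names are the union of the terms of all
    stages. *)
Inductive name : ty -> Type := Name i : name (newty i).

Definition name_index τ (a : name τ) : nat := let: Name i := a in i.

Inductive ctm : ty -> Type :=
| CName τ : name τ -> ctm τ
| CCst τ : cst τ -> ctm τ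
| CApp σ τ : ctm (σ ⇒ τ) -> ctm σ -> ctm τ.

Fixpoint toname m : forall τ, var (ctx (chain m)) τ -> name τ :=
  match m return forall τ, var (ctx (chain m)) τ -> name τ with
  | 0 => fun τ x => var_nilP (name τ) x
  | m.+1 => vcase (Name m) (@toname m)
  end.

Lemma name_index_lt m τ (x : var (ctx (chain m)) τ) : name_index (toname x) < m.
Proof.
elim: m τ x => [|m IH] τ; first by move=> x; apply: var_nilP x.
move: τ; apply: var_consP => [|τ y] /=; first exact: ltnSn.
exact: leq_trans (IH _ _) (leqnSn _).
Qed.

Lemma toname_inj m τ (x y : var (ctx (chain m)) τ) : toname x = toname y -> x = y.
Proof.
suff h τ1 τ2 (x1 : var (ctx (chain m)) τ1) (x2 : var (ctx (chain m)) τ2) :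
    name_index (toname x1) = name_index (toname x2) ->
    existT (var _) τ1 x1 = existT _ τ2 x2.
  by move=> e; apply/inj_pairT/h; rewrite e.
elim: m {τ x y} τ1 τ2 x1 x2 => [|m IH] τ1 τ2; first by move=> x; apply: var_nilP x.
move=> x1 x2; move: τ1 x1.
apply: var_consP => [|τ1 x1]; move: τ2 x2; apply: var_consP => [|τ2 x2] //=.
- by move=> e; have := name_index_lt x2; rewrite -e ltnn.
- by move=> e; have := name_index_lt x1; rewrite e ltnn.
- by move=> /IH e; exact: (f_equal (fun p => existT (var _) _ (vs (projT2 p))) e).
Qed.

Fixpoint embed m τ (t : tm (ctx (chain m)) τ) : ctm τ :=
  match t with
  | Var _ x => CName (toname x)
  | Cst _ c => CCst c
  | App _ _ t u => CApp (embed t) (embed u)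
  end.

Lemma embed_wk m τ (t : tm (ctx (chain m)) τ) : embed (m := m.+1) (wk t) = embed t.
Proof. by elim: t => //= ? ? t -> u ->. Qed.

Lemma embed_inj m τ (t u : tm (ctx (chain m)) τ) : embed t = embed u -> t = u.
Proof.
suff h τ' (v : tm (ctx (chain m)) τ') :
    existT ctm _ (embed t) = existT _ _ (embed v) -> existT (tm _) _ t = existT _ _ v.
  by move=> e; apply/inj_pairT/h; rewrite e.
elim: t {u} τ' v => {τ} [τ x|τ c|σ τ t IHt u IHu] τ' [τ1 x1|τ1 c1|σ1 τ1 t1 u1] /= e.
- have /= e1 := f_equal (@projT1 _ _) e; subst τ1; have [e2] := inj_pairT e.
  by rewrite (toname_inj (inj_pairT e2)).
- by case: (e).
- by case: (e).
- by case: (e).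
- have /= e1 := f_equal (@projT1 _ _) e; subst τ1; have [e2] := inj_pairT e.
  by rewrite (inj_pairT e2).
- by case: (e).
- by case: (e).
- by case: (e).
- have /= e1 := f_equal (@projT1 _ _) e; subst τ1; have [e2 e3 e4] := inj_pairT e.
  subst σ1.
  have et := IHt _ t1 (f_equal _ (inj_pairT (inj_pairT e3))).
  have eu := IHu _ u1 (f_equal _ (inj_pairT e4)).
  by rewrite (inj_pairT et) (inj_pairT eu).
Qed.

Definition represents Γ m (s : sub Γ (ctx (chain m))) (ρ : forall τ, var Γ τ -> ctm τ) :=
  forall τ (x : var Γ τ), embed (s τ x) = ρ τ x.

Definition wks Γ Δ σ (s : sub Γ Δ) : sub Γ (σ :: Δ) := fun τ x => wk (s τ x).

Lemma represents_wk Γ m (s : sub Γ (ctx (chain m))) ρ :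
  represents s ρ -> represents (m := m.+1) (@wks _ _ (newty m) s) ρ.
Proof. by move=> h τ x; rewrite /wks embed_wk. Qed.

Lemma represents_inj Γ m (s s' : sub Γ (ctx (chain m))) ρ :
  represents s ρ -> represents s' ρ -> s = s'.
Proof. by move=> h h'; apply: sub_ext => τ x; apply: embed_inj; rewrite h h'. Qed.

Lemma embed_surj τ (t : ctm τ) :
  exists n, forall m, n <= m -> exists u : tm (ctx (chain m)) τ, embed u = t.
Proof.
elim: t => {τ} [τ [i]|τ c|σ τ t [n1 IH1] u [n2 IH2]].
- exists i.+1 => m /subnK <-; elim: (m - i.+1) => [|k [u IH]].
    by exists (Var vz).
  by exists (wk u : tm (ctx (chain (k + i.+1).+1)) _); rewrite embed_wk.
- by exists 0 => m _; exists (Cst c).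
- exists (maxn n1 n2) => m; rewrite geq_max => /andP[/IH1[t' <-] /IH2[u' <-]].
  by exists (App t' u').
Qed.

Lemma represents_ex Γ (ρ : forall τ, var Γ τ -> ctm τ) :
  exists n, forall m, n <= m -> exists s : sub Γ (ctx (chain m)), represents s ρ.
Proof.
elim: Γ ρ => [|σ Γ IH] ρ.
  by exists 0 => m _; exists (fun τ x => var_nilP (tm _ τ) x) => τ x; apply: var_nilP x.
have [n1 h1] := IH (fun τ x => ρ τ (vs x)); have [n2 h2] := embed_surj (ρ _ vz).
exists (maxn n1 n2) => m; rewrite geq_max => /andP[/h1[s sP] /h2[u uP]].
by exists (scons u s); apply: var_consP.
Qed.

Definition holds Γ (φ : fm Γ) (ρ : forall τ, var Γ τ -> ctm τ) : Prop :=
  exists m (s : sub Γ (ctx (chain m))),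
    represents s ρ /\ prv T (hyps (chain m)) (sub_fm φ s).

Lemma prv_next m (φ : fm (ctx (chain m))) :
  prv T (hyps (chain m)) φ -> prv T (hyps (chain m.+1)) (wk_fm φ).
Proof.
move=> /(prv_wk T_sub (newty m)); apply: prv_mono => x xH.
by apply: in_or_app; right; right.
Qed.

(** Weakening keeps a proof valid at every later stage, and by injectivity of [embed] only one
    substitution represents [ρ] there. *)
Lemma holds_late Γ (φ : fm Γ) ρ : holds φ ρ ->
  exists n, forall m, n <= m -> forall s : sub Γ (ctx (chain m)),
    represents s ρ -> prv T (hyps (chain m)) (sub_fm φ s).
Proof.
move=> [n [s [sP d]]]; exists n => m /subnK <- s' s'P.
suff [s1 [s1P d1]] : exists s1 : sub Γ (ctx (chain (m - n + n))),
    represents s1 ρ /\ prv T (hyps (chain (m - n + n))) (sub_fm φ s1).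
  by rewrite (represents_inj s'P s1P).
elim: (m - n) => [|k [s1 [s1P d1]]]; first by exists s.
exists (@wks _ _ (newty (k + n)) s1); split; first exact: represents_wk.
by rewrite -wk_fm_sub; apply: prv_next.
Qed.

(** Premises proved at different stages are brought to a common later one. A rule with a single
    premise is applied by supplying that premise twice. *)
Lemma holds_rule Γ (φ ψ χ : fm Γ) ρ :
  (forall Δ (H : list (fm Δ)) s, prv T H (sub_fm φ s) -> prv T H (sub_fm ψ s) ->
     prv T H (sub_fm χ s)) ->
  holds φ ρ -> holds ψ ρ -> holds χ ρ.
Proof.
move=> rule /holds_late[n1 h1] /holds_late[n2 h2].
have [n3 h3] := represents_ex ρ.
pose m := maxn n1 (maxn n2 n3).
have [s sP] : exists s : sub Γ (ctx (chain m)), represents s ρ.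
  by apply: h3; rewrite !leq_max leqnn !orbT.
exists m, s; split=> //; apply: rule.
  by apply: h1 => //; rewrite leq_max leqnn.
by apply: h2 => //; rewrite !leq_max leqnn orbT.
Qed.

(** Once [ρ] is represented at stage [n], the formula is entry [j] of row [n] of the agenda, and the
    entry coded by [m] is decided at step [m]. *)
Lemma agenda_chain Γ (φ : fm Γ) ρ : exists m (s : sub Γ (ctx (chain m))),
  represents s ρ /\
  let ψ := current (chain m) m in ψ = sub_fm φ s \/ ψ = Neg (sub_fm φ s).
Proof.
have [n h] := represents_ex ρ; have [s sP] := h n (leqnn n).
have [j jP] := fm_enumP (sub_fm φ s).
have ag0 : agenda (chain n) n j = sub_fm φ s.
  by rewrite -jP; case: (n) => //= n'; rewrite eqxx.
have ag k : exists s' : sub Γ (ctx (chain (k + n))),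
    represents s' ρ /\ agenda (chain (k + n)) n j = sub_fm φ s'.
  elim: k => [|k [s' [s'P e]]]; first by exists s.
  exists (@wks _ _ (newty (k + n)) s'); split; first exact: represents_wk.
  rewrite /= ltn_eqF; last by rewrite ltnS leq_addl.
  by rewrite e wk_fm_sub.
(* The Cantor code bounds its components, so the formula is not due before its context exists. *)
pose m := Cantor.to_nat (n, j).
have le_nm : n <= m.
  have /leP := Cantor.to_nat_non_decreasing n j.
  by apply: leq_trans; rewrite leq_addl.
have := ag (m - n); rewrite subnK // => -[s' [s'P e]].
exists m, s'; split=> //=.
rewrite /current {2 4}/m Cantor.cancel_of_to e /decide.
by case: pselect; [left|right].
Qed.

Lemma current_holds m : prv T (hyps (chain m.+1)) (wk_fm (current (chain m) m)).
Proof. by apply: prv_hyp; apply: in_or_app; right; left. Qed.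

Lemma holds_em Γ (φ : fm Γ) ρ : holds φ ρ \/ holds (Neg φ) ρ.
Proof.
have [m [s [sP /= h]]] := agenda_chain φ ρ.
have d := current_holds m.
case: h => e; [left|right]; exists m.+1, (@wks _ _ (newty m) s);
  (split; first exact: represents_wk); rewrite -wk_fm_sub; first by rewrite -e.
by rewrite [sub_fm (Neg φ) s](esym e).
Qed.

Lemma holds_contra Γ (φ : fm Γ) ρ : holds φ ρ -> ~ holds (Neg φ) ρ.
Proof.
move=> h h'; have [m [s [_ d]]] : holds Bot ρ.
  by apply: (holds_rule _ h' h) => Δ H s; apply: prv_impE.
exact: (chain_consistent d).
Qed.

Lemma witness_ex Γ (φ : fm Γ) σ (ψ : fm (σ :: Γ)) : φ = Ex σ ψ ->
  exists x : var (projT1 (witness φ) :: Γ) σ,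
    In (sub_fm ψ (scons (Var x) (fun _ y => Var (vs y)))) (projT2 (witness φ)).
Proof.
move=> ->; exists vz; left; rewrite -[LHS]sub_fm_Var; congr sub_fm.
by apply: sub_ext; apply: var_consP.
Qed.

(** The formula is decided at some step. A negative decision would contradict consistency, and a
    positive one adds an instance with the newest variable. *)
Lemma holds_witness Γ σ (φ : fm (σ :: Γ)) ρ :
  holds (Ex σ φ) ρ -> exists a : ctm σ, holds φ (vcase a ρ).
Proof.
move=> h; have [m [s [sP /= e]]] := agenda_chain (Ex σ φ) ρ.
case: e => e; last first.
  case: (holds_contra h); exists m.+1, (@wks _ _ (newty m) s).
  split; first exact: represents_wk.
  by rewrite -wk_fm_sub [sub_fm (Neg _) s](esym e); apply: current_holds.
have [x xP] := witness_ex e.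
exists (embed (m := m.+1) (Var x)), m.+1.
exists (scons (Γ := Γ) (Δ := ctx (chain m.+1)) (Var x) (@wks _ _ (newty m) s)); split.
  apply: var_consP => // τ y; exact: represents_wk.
apply: prv_hyp; apply: in_or_app; left; move: xP; rewrite sub_fm_comp.
congr (In (sub_fm _ _) _); apply: scons_eta => // τ y /=.
by rewrite sub_tm_wk /= /wks /wk ren_tm_sub.
Qed.

Lemma holds_all Γ σ (φ : fm (σ :: Γ)) ρ a : holds (All σ φ) ρ -> holds φ (vcase a ρ).
Proof.
move=> /holds_late[n1 h1]; have [n2 h2] := represents_ex ρ.
have [n3 h3] := embed_surj a.
pose m := maxn n1 (maxn n2 n3).
have [|s sP] := h2 m; first by rewrite !leq_max leqnn !orbT.
have [|t tP] := h3 m; first by rewrite !leq_max leqnn !orbT.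
exists m, (scons t s); split; first by apply: var_consP.
by rewrite -inst_up; apply: prv_allE; apply: h1 => //; rewrite leq_max leqnn.
Qed.

Lemma holds_ex Γ σ (φ : fm (σ :: Γ)) ρ a : holds φ (vcase a ρ) -> holds (Ex σ φ) ρ.
Proof.
move=> /holds_late[n1 h1]; have [n2 h2] := represents_ex ρ.
have [n3 h3] := embed_surj a.
pose m := maxn n1 (maxn n2 n3).
have [|s sP] := h2 m; first by rewrite !leq_max leqnn !orbT.
have [|t tP] := h3 m; first by rewrite !leq_max leqnn !orbT.
exists m, s; split=> //=; apply: (prv_exI (t := t)); rewrite inst_up.
by apply: h1; [rewrite leq_max leqnn|apply: var_consP].
Qed.

Definition henkin : structure := {|
  dom := ctm;
  ap := CApp;
  icst := CCst;
  ieq a b := exists m (t u : tm (ctx (chain m)) N),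
    [/\ embed t = a, embed u = b & prv T (hyps (chain m)) (t ≐ u)] |}.

Lemma embed_eval Γ m (s : sub Γ (ctx (chain m))) (ρ : env henkin Γ) τ (t : tm Γ τ) :
  represents s ρ -> embed (sub_tm s t) = eval t ρ.
Proof. by move=> sP; elim: t => //= ? ? t -> u ->. Qed.

Lemma truth Γ (φ : fm Γ) (ρ : env henkin Γ) : sat φ ρ <-> holds φ ρ.
Proof.
elim: φ ρ => {Γ} /=.
- move=> Γ t u ρ; split=> [[m [t' [u' [et eu d]]]]|[m [s [sP d]]]]; last first.
    by exists m, (sub_tm s t), (sub_tm s u); split=> //; apply: embed_eval.
  have [n h] := represents_ex ρ.
  (* The two terms come from a stage at which [ρ] may not be represented. Read as values of two
     variables, they let [holds_late] carry the equation to a stage where it is. *)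
  pose s0 : sub [N; N] (ctx (chain m)) := scons t' (scons u' (fun τ x => var_nilP (tm _ τ) x)).
  pose ρ0 := fun τ x => embed (s0 τ x).
  have /holds_late[n' h'] : holds (v0 ≐ v1) ρ0 by exists m, s0.
  have [|s sP] := h (maxn n n'); first by rewrite leq_maxl.
  exists (maxn n n'), s; split=> //=.
  pose s1 := scons (sub_tm s t) (scons (sub_tm s u)
    (fun τ x => var_nilP (tm (ctx (chain (maxn n n'))) τ) x)).
  apply: (h' _ (leq_maxr _ _) s1).
  apply: var_consP => [|τ]; first by rewrite /ρ0 /= et; apply: embed_eval.
  move: τ; apply: var_consP => [|τ x]; last exact: var_nilP x.
  by rewrite /ρ0 /= eu; apply: embed_eval.
- move=> Γ ρ; split=> // -[m [s [_ d]]]; exact: (chain_consistent d).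
- move=> Γ φ IH ψ IH' ρ; split=> [h|h /IH h']; last first.
    by apply/IH'; apply: (holds_rule _ h h') => Δ H s; apply: prv_impE.
  have [/IH/h/IH' hψ|hn] := holds_em φ ρ.
    apply: (holds_rule _ hψ hψ) => Δ H s d _; apply/prv_impI/(prv_mono _ d) => x; by right.
  apply: (holds_rule _ hn hn) => Δ H s d _; apply/prv_impI/prv_absurd.
  apply: prv_impE (prv_mono _ d) _; first by move=> x; right.
  by apply: prv_hyp; left.
- move=> Γ φ IH ψ IH' ρ; split=> [[/IH h /IH' h']|h].
    by apply: (holds_rule _ h h') => Δ H s; apply: prv_andI.
  split; [apply/IH|apply/IH']; apply: (holds_rule _ h h) => Δ H s d _.
    exact: prv_andE1 d.
  exact: prv_andE2 d.
- move=> Γ φ IH ψ IH' ρ; split=> [[/IH h|/IH' h]|h].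
  + by apply: (holds_rule _ h h) => Δ H s d _; apply: prv_orI1.
  + by apply: (holds_rule _ h h) => Δ H s d _; apply: prv_orI2.
  have [/IH|hn] := holds_em φ ρ; first by left.
  right; apply/IH'; apply: (holds_rule _ h hn) => Δ H s d d'.
  apply: prv_orE d _ _; last by apply: prv_hyp; left.
  apply/prv_absurd/prv_impE; first by apply: prv_mono d'; move=> x; right.
  by apply: prv_hyp; left.
- move=> Γ σ φ IH ρ; split=> [h|h a]; last exact/IH/holds_all.
  have [//|hn] := holds_em (All σ φ) ρ.
  have [hn'|hn'] := holds_em (Ex σ (Neg φ)) ρ.
    have [a ha] := holds_witness hn'.
    by have /IH/holds_contra := h a.
  by apply: (holds_rule _ hn' hn') => Δ H s d _; apply: prv_all_of_not_ex_not.
- move=> Γ σ φ IH ρ; split=> [[a /IH h]|/holds_witness[a /IH h]].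
    exact: holds_ex h.
  by exists a.
Qed.

Lemma henkin_models : models henkin T.
Proof.
move=> Γ φ ρ Tφ; apply/truth; have [n h] := represents_ex ρ.
have [s sP] := h n (leqnn n); exists n, s; split=> //.
exact/prv_ax/T_sub.
Qed.

Lemma henkin_refutes : ~ sat φ0 (enil henkin).
Proof.
move=> /truth/holds_contra; apply; exists 0, (fun τ x => Var x).
split; first by move=> τ x; apply: var_nilP x.
by rewrite sub_fm_Var; apply: prv_hyp; left.
Qed.

End Completeness.

Theorem completeness (T : forall Γ, fm Γ -> Prop) (φ : fm []) :
  (forall Γ Δ (ψ : fm Γ) (s : sub Γ Δ), T _ ψ -> T _ (sub_fm ψ s)) ->
  (forall M, models M T -> sat φ (enil M)) -> proves T φ.
Proof.
move=> T_sub h; apply: contrapT => u.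
exact: (henkin_refutes T_sub u (h _ (henkin_models T_sub u))).
Qed.

(** * Closure of the axioms under substitution *)

Lemma sub_eqt τ Γ Δ (t u : tm Γ τ) (s : sub Γ Δ) :
  sub_fm (eqt t u) s = eqt (sub_tm s t) (sub_tm s u).
Proof.
elim: τ Γ Δ t u s => [//|σ _ τ IH] Γ Δ t u s /=.
by rewrite IH /= !sub_tm_up_wk.
Qed.

Lemma qf_sub Γ (φ : fm Γ) Δ (s : sub Γ Δ) : qf φ -> qf (sub_fm φ s).
Proof.
by elim: φ Δ s => {Γ} //= Γ φ IH ψ IH' Δ s [/IH h /IH' h'].
Qed.

Lemma RCA0w_sub Γ Δ (φ : fm Γ) (s : sub Γ Δ) : RCA0w φ -> RCA0w (sub_fm φ s).
Proof.
move=> ax; case: ax Δ s => {Γ φ} /=; try by move=> *; constructor.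
- by move=> Γ σ τ Δ s; rewrite sub_eqt; constructor.
- by move=> Γ ρ σ τ Δ s; rewrite sub_eqt; constructor.
- by move=> Γ ρ τ Δ s; rewrite !sub_eqt; constructor.
- move=> Γ φ qfφ Δ s; rewrite sub_inst.
  (* The successor substitution of the induction step commutes with [up s], so the result is again
     an instance of the induction axiom. *)
  have -> : sub_fm (sub_fm φ (scons (succ v0) (fun _ x => Var (vs x)))) (up s) =
            sub_fm (sub_fm φ (up s)) (scons (succ v0) (fun _ x => Var (vs x))).
    rewrite !sub_fm_comp; congr sub_fm; apply: sub_ext; apply: var_consP => //= τ x.
    by rewrite sub_tm_wk /= /wk ren_tm_sub.
  exact/ax_qfind/qf_sub.
Qed.

Lemma ACA0w_QFAC01_sub Γ Δ (φ : fm Γ) (s : sub Γ Δ) :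
  ACA0w_QFAC01 φ -> ACA0w_QFAC01 (sub_fm φ s).
Proof.
move=> ax; case: ax Δ s => {Γ φ} [Γ φ ax|Γ] Δ s; last exact: ax_qfac01.
apply: ACA0w_QFAC01_base; case: ax Δ s => {Γ φ} [Γ φ ax|Γ] Δ s; last exact: ax_exists2.
exact/ACA0w_base/RCA0w_sub.
Qed.

(** * Extensional models *)

Lemma sat_All M Γ σ (φ : fm (σ :: Γ)) (ρ : env M Γ) :
  sat (All σ φ) ρ <-> forall a, sat φ (econs a ρ).
Proof. by []. Qed.

Lemma sat_Ex M Γ σ (φ : fm (σ :: Γ)) (ρ : env M Γ) :
  sat (Ex σ φ) ρ <-> exists a, sat φ (econs a ρ).
Proof. by []. Qed.

Lemma eval_ren M Γ Δ (r : ren Γ Δ) (ρ : env M Δ) τ (t : tm Γ τ) :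
  eval (ren_tm r t) ρ = eval t (fun τ x => ρ τ (r τ x)).
Proof. by elim: t => //= ? ? t -> u ->. Qed.

Lemma eval_wk M Γ σ (a : dom M σ) (ρ : env M Γ) τ (t : tm Γ τ) :
  eval (wk t) (econs a ρ) = eval t ρ.
Proof. exact: eval_ren. Qed.

Lemma eval_sub M Γ Δ (s : sub Γ Δ) (ρ : env M Δ) τ (t : tm Γ τ) :
  eval (sub_tm s t) ρ = eval t (fun τ x => eval (s τ x) ρ).
Proof. by elim: t => //= ? ? t -> u ->. Qed.

Lemma eval_up M Γ Δ (s : sub Γ Δ) σ (a : dom M σ) (ρ : env M Δ) :
  (fun τ x => eval (up s τ x) (econs a ρ)) = econs a (fun τ x => eval (s τ x) ρ).
Proof. by apply: env_ext; apply: var_consP => //= τ x; exact: eval_wk. Qed.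

Lemma sat_sub M Γ (φ : fm Γ) Δ (s : sub Γ Δ) (ρ : env M Δ) :
  sat (sub_fm φ s) ρ <-> sat φ (fun τ x => eval (s τ x) ρ).
Proof.
elim: φ Δ s ρ => {Γ} //=.
- by move=> Γ t u Δ s ρ; rewrite !eval_sub.
- by move=> Γ φ IH ψ IH' Δ s ρ; rewrite IH IH'.
- by move=> Γ φ IH ψ IH' Δ s ρ; rewrite IH IH'.
- by move=> Γ φ IH ψ IH' Δ s ρ; rewrite IH IH'.
- by move=> Γ σ φ IH Δ s ρ; split=> h a; have := h a; rewrite IH eval_up.
- by move=> Γ σ φ IH Δ s ρ; split=> -[a h]; exists a; move: h; rewrite IH eval_up.
Qed.

Lemma sat_wk_fm M Γ σ (φ : fm Γ) (a : dom M σ) (ρ : env M Γ) :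
  sat (wk_fm φ) (econs a ρ) <-> sat φ ρ.
Proof. exact: sat_sub. Qed.

Fixpoint eqv M τ : dom M τ -> dom M τ -> Prop :=
  match τ with
  | N => fun a b => ieq a b
  | Arr σ τ => fun f g => forall a, eqv (ap f a) (ap g a)
  end.

Lemma sat_eqt M τ Γ (t u : tm Γ τ) (ρ : env M Γ) :
  sat (eqt t u) ρ <-> eqv (eval t ρ) (eval u ρ).
Proof.
elim: τ Γ t u ρ => [//|σ _ τ IH] Γ t u ρ /=.
by split=> h a; have := h a; rewrite IH /= !eval_wk.
Qed.

(** * The quotient by extensional equality *)

Section Quotient.
Variable M : structure.
Hypothesis M_RCA0w : models M RCA0w.

Lemma eqv_refl τ (a : dom M τ) : eqv a a.
Proof.
elim: τ a => [|σ _ τ IH] a; last by move=> b; apply: IH.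
exact: (M_RCA0w (enil M) (ax_refl [])).
Qed.

Lemma eqv_sym τ (a b : dom M τ) : eqv a b -> eqv b a.
Proof.
elim: τ a b => [|σ _ τ IH] a b; last by move=> h c; apply: IH.
exact: (M_RCA0w (enil M) (ax_sym [])).
Qed.

Lemma eqv_trans τ (a b c : dom M τ) : eqv a b -> eqv b c -> eqv a c.
Proof.
elim: τ a b c => [|σ _ τ IH] a b c; last by move=> h h' d; apply: IH (h d) (h' d).
exact: (M_RCA0w (enil M) (ax_trans [])).
Qed.

(** Here the extensionality axiom enters: it makes application well defined on classes. *)
Lemma eqv_ap σ τ (f g : dom M (σ ⇒ τ)) (a b : dom M σ) :
  eqv f g -> eqv a b -> eqv (ap f a) (ap g b).
Proof.
move=> efg eab; apply: eqv_trans (efg a) _.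
pose ρ : env M [σ ⇒ τ; σ; σ] := econs g (econs b (econs a (enil M))).
have : sat (eqt v2 v1) ρ -> sat (eqt (v0 ⋅ v2) (v0 ⋅ v1)) ρ.
  exact: (M_RCA0w (enil M) (ax_ext [] σ τ) a b g).
by rewrite !sat_eqt; apply.
Qed.

(** A class is encoded as a predicate, so that function and propositional extensionality turn
    equivalence of elements into Leibniz equality of classes. *)
Definition qdom τ := {P : dom M τ -> Prop | exists a, P = eqv a}.

Definition cls τ (a : dom M τ) : qdom τ := exist _ (eqv a) (ex_intro _ a erefl).

Definition qrepr τ (c : qdom τ) : dom M τ := sval (cid (svalP c)).

Lemma cls_eqv τ (a b : dom M τ) : cls a = cls b <-> eqv a b.
Proof.
split=> [/(f_equal sval)/= e|h]; first by rewrite e; apply: eqv_refl.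
apply: eq_exist; apply/funext => c; apply/propext; split.
  by apply: eqv_trans; apply: eqv_sym.
exact: eqv_trans.
Qed.

Lemma qreprK τ (c : qdom τ) : cls (qrepr c) = c.
Proof. by case: c => P h; apply: eq_exist; rewrite /qrepr /=; case: cid. Qed.

Definition quotient : structure := {|
  dom := qdom;
  ap σ τ f a := cls (ap (qrepr f) (qrepr a));
  icst τ c := cls (icst M c);
  ieq := eq |}.

Lemma cls_ap σ τ (f : dom M (σ ⇒ τ)) a :
  ap (s := quotient) (cls f) (cls a) = cls (ap f a).
Proof. by apply/cls_eqv/eqv_ap; apply/cls_eqv; rewrite qreprK. Qed.

Definition cls_env Γ (ρ : env M Γ) : env quotient Γ := fun τ x => cls (ρ τ x).

Lemma cls_env_surj Γ (ρ : env quotient Γ) : exists ρ', ρ = cls_env ρ'.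
Proof.
by exists (fun τ x => qrepr (ρ τ x)); apply: env_ext => τ x; rewrite /cls_env qreprK.
Qed.

Lemma cls_econs Γ σ (a : dom M σ) (ρ : env M Γ) :
  econs (M := quotient) (cls a) (cls_env ρ) = cls_env (econs a ρ).
Proof. by apply: env_ext; apply: var_consP. Qed.

Lemma eval_quotient Γ τ (t : tm Γ τ) (ρ : env M Γ) :
  eval t (cls_env ρ) = cls (eval t ρ).
Proof.
elim: t => // σ τ' t IH u IH'.
by rewrite -[LHS]/(ap (eval t _) (eval u _)) IH IH' cls_ap.
Qed.

Lemma sat_quotient Γ (φ : fm Γ) (ρ : env M Γ) : sat φ (cls_env ρ) <-> sat φ ρ.
Proof.
elim: φ ρ => {Γ} //.
- by move=> Γ t u ρ; rewrite [sat _ _]/= !eval_quotient cls_eqv.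
- by move=> Γ φ IH ψ IH' ρ /=; rewrite IH IH'.
- by move=> Γ φ IH ψ IH' ρ /=; rewrite IH IH'.
- by move=> Γ φ IH ψ IH' ρ /=; rewrite IH IH'.
- move=> Γ σ φ IH ρ; rewrite !sat_All; split=> h a.
    by rewrite -IH -cls_econs; apply: h.
  by rewrite -(qreprK a) cls_econs IH.
- move=> Γ σ φ IH ρ; rewrite !sat_Ex; split=> -[a h].
    by exists (qrepr a); rewrite -IH -cls_econs qreprK.
  by exists (cls a); rewrite cls_econs IH.
Qed.

Lemma quotient_models T : models M T -> models quotient T.
Proof.
by move=> h Γ φ ρ /h hφ; have [ρ' ->] := cls_env_surj ρ; apply/sat_quotient.
Qed.

Lemma quotient_ext σ τ (f g : dom quotient (σ ⇒ τ)) :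
  (forall a, ap f a = ap g a) -> f = g.
Proof.
rewrite -(qreprK f) -(qreprK g) => h; apply/cls_eqv => a /=.
by apply/cls_eqv; have := h (cls a); rewrite !cls_ap.
Qed.

End Quotient.

Record model := Model {
  mdom : ty -> Type;
  mapp : forall σ τ, mdom (σ ⇒ τ) -> mdom σ -> mdom τ;
  mcst : forall τ, cst τ -> mdom τ }.

Coercion structure_of_model (M : model) : structure :=
  {| dom := mdom M; ap := @mapp M; icst := @mcst M; ieq := @eq (mdom M N) |}.

Arguments dom : simpl never.
Arguments ap : simpl never.
Arguments icst : simpl never.

Theorem extensional_completeness (T : forall Γ, fm Γ -> Prop) (φ : fm []) :
  (forall Γ Δ (ψ : fm Γ) (s : sub Γ Δ), T _ ψ -> T _ (sub_fm ψ s)) ->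
  (forall Γ (ψ : fm Γ), RCA0w ψ -> T _ ψ) ->
  (forall M : model, models M T ->
     (forall σ τ (f g : dom M (σ ⇒ τ)), (forall a, ap f a = ap g a) -> f = g) ->
     sat φ (enil M)) ->
  proves T φ.
Proof.
move=> T_sub T_RCA h; apply: (completeness T_sub) => M MT.
have M_RCA0w : models M RCA0w by move=> Γ ψ ρ /T_RCA; apply: MT.
apply/(sat_quotient M_RCA0w); rewrite [cls_env _]env_nil.
apply: (h (Model (@ap (quotient M)) (@icst (quotient M)))).
  exact: (quotient_models M_RCA0w MT).
exact: (quotient_ext M_RCA0w).
Qed.

(** * Arithmetic in a model *)

Section Arithmetic.
Variable M : model.
Hypothesis M_models : models M ACA0w_QFAC01.
Hypothesis M_ext :
  forall σ τ (f g : dom M (σ ⇒ τ)), (forall a, ap f a = ap g a) -> f = g.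

Local Notation "f ∙ a" := (ap f a) (at level 40, left associativity).

Lemma RCA0w_valid Γ (φ : fm Γ) (ρ : env M Γ) : RCA0w φ -> sat φ ρ.
Proof. by move=> h; apply: M_models; do 2!constructor. Qed.

(** The combinator axioms assert only pointwise equality. This turns them into equations in the
    model, after which bracket abstraction computes like beta reduction. *)
Lemma eqv_eq τ (a b : dom M τ) : eqv a b <-> a = b.
Proof.
elim: τ a b => [//|σ _ τ IH] f g; split=> [h|-> a]; last exact/IH.
by apply: M_ext => a; apply/IH.
Qed.

Lemma apK σ τ (a : dom M σ) (b : dom M τ) : icst M (cK σ τ) ∙ a ∙ b = a.
Proof.
have : sat (eqt (Cst (cK σ τ) ⋅ v1 ⋅ v0) v1) (econs b (econs a (enil M))).
  exact: (RCA0w_valid (enil M) (ax_K [] σ τ) a b).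
by rewrite sat_eqt eqv_eq.
Qed.

Lemma apS ρ σ τ (f : dom M (ρ ⇒ σ ⇒ τ)) (g : dom M (ρ ⇒ σ)) (a : dom M ρ) :
  icst M (cS ρ σ τ) ∙ f ∙ g ∙ a = f ∙ a ∙ (g ∙ a).
Proof.
have : sat (eqt (Cst (cS ρ σ τ) ⋅ v2 ⋅ v1 ⋅ v0) (v2 ⋅ v0 ⋅ (v1 ⋅ v0)))
           (econs a (econs g (econs f (enil M)))).
  exact: (RCA0w_valid (enil M) (ax_S [] ρ σ τ) f g a).
by rewrite sat_eqt eqv_eq.
Qed.

Lemma eval_lam Γ σ τ (t : tm (σ :: Γ) τ) (ρ : env M Γ) (a : dom M σ) :
  eval (lam t) ρ ∙ a = eval t (econs a ρ).
Proof.
elim: t => [τ' x|τ' c|σ' τ' t IHt u IHu]; last by rewrite /= apS IHt IHu.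
  move: τ' x; apply: var_consP => [|τ' x] /=; first by rewrite apS apK.
  exact: apK.
exact: apK.
Qed.

Definition zr : dom M N := icst M cZero.
Definition sc (n : dom M N) : dom M N := icst M cSucc ∙ n.
Definition add m n := eval (addN v0 v1) (econs m (econs n (enil M))).
Definition mul m n := eval (mulN v0 v1) (econs m (econs n (enil M))).
Definition prd n := eval (predN v0) (econs n (enil M)).
Definition mns m n := eval (monus v0 v1) (econs m (econs n (enil M))).

Lemma rec0 (f : dom M (N ⇒ N ⇒ N)) a : icst M cRec ∙ f ∙ a ∙ zr = a.
Proof. exact: (RCA0w_valid (enil M) (ax_rec0 []) f a). Qed.

Lemma recS (f : dom M (N ⇒ N ⇒ N)) a n :
  icst M cRec ∙ f ∙ a ∙ sc n = f ∙ n ∙ (icst M cRec ∙ f ∙ a ∙ n).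
Proof. exact: (RCA0w_valid (enil M) (ax_recS []) f a n). Qed.

Lemma sc_neq0 n : sc n <> zr.
Proof. exact: (RCA0w_valid (enil M) (ax_succ_neq0 []) n). Qed.

Lemma add0 m : add m zr = m. Proof. exact: rec0. Qed.
Lemma addS m n : add m (sc n) = sc (add m n).
Proof. by rewrite /add /= recS apK. Qed.
Lemma mul0 m : mul m zr = zr. Proof. exact: rec0. Qed.
Lemma mulS m n : mul m (sc n) = add m (mul m n).
Proof. by rewrite /mul /= recS apK. Qed.
Lemma prd0 : prd zr = zr. Proof. exact: rec0. Qed.
Lemma prdS n : prd (sc n) = n. Proof. by rewrite /prd /= recS apK. Qed.
Lemma mns0 m : mns m zr = m. Proof. exact: rec0. Qed.
Lemma mnsS m n : mns m (sc n) = prd (mns m n).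
Proof. by rewrite /mns /= recS apK. Qed.

(** In a nonstandard model induction is available only for formulas. Each law below therefore names
    its formula, with parameters in the environment, and [sat] of that formula converts to the
    equation wanted. *)
Lemma qf_induction Γ (φ : fm (N :: Γ)) (ρ : env M Γ) : qf φ ->
  sat φ (econs zr ρ) ->
  (forall n, sat φ (econs n ρ) -> sat φ (econs (sc n) ρ)) ->
  forall n, sat φ (econs n ρ).
Proof.
move=> qfφ h0 hS; have h : sat _ ρ := RCA0w_valid ρ (ax_qfind qfφ).
apply: h; split.
  apply/sat_sub; congr (sat _ _): h0.
  by apply: env_ext; apply: var_consP.
move=> n /hS hn; apply/sat_sub; congr (sat _ _): hn.
by apply: env_ext; apply: var_consP.
Qed.

Definition env1 a : env M [N] := econs a (enil M).
Definition env2 a b : env M [N; N] := econs a (env1 b).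

Lemma add0l n : add zr n = n.
Proof.
apply: (qf_induction (φ := addN zero v0 ≐ v0) (ρ := enil M)) => //; first exact: add0.
by move=> m h; rewrite -[sat _ _]/(add zr (sc m) = sc m) addS; congr sc.
Qed.

Lemma addSl m n : add (sc m) n = sc (add m n).
Proof.
apply: (qf_induction (φ := addN (succ v1) v0 ≐ succ (addN v1 v0)) (ρ := env1 m)) => //.
  by rewrite -[sat _ _]/(add (sc m) zr = sc (add m zr)) !add0.
by move=> k h; rewrite -[sat _ _]/(add (sc m) (sc k) = sc (add m (sc k))) !addS; congr sc.
Qed.

Lemma addC m n : add m n = add n m.
Proof.
apply: (qf_induction (φ := addN v1 v0 ≐ addN v0 v1) (ρ := env1 m)) => //.
  by rewrite -[sat _ _]/(add m zr = add zr m) add0 add0l.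
move=> k h; rewrite -[sat _ _]/(add m (sc k) = add (sc k) m) addS addSl; congr sc.
exact: h.
Qed.

Lemma addA m n p : add m (add n p) = add (add m n) p.
Proof.
apply: (qf_induction (φ := addN v1 (addN v2 v0) ≐ addN (addN v1 v2) v0)
  (ρ := env2 m n)) => //.
  by rewrite -[sat _ _]/(add m (add n zr) = add (add m n) zr) !add0.
move=> k h; rewrite -[sat _ _]/(add m (add n (sc k)) = add (add m n) (sc k)) !addS.
congr sc; exact: h.
Qed.

Lemma addCA m n p : add m (add n p) = add n (add m p).
Proof. by rewrite !addA (addC m n). Qed.

Lemma mul0l n : mul zr n = zr.
Proof.
apply: (qf_induction (φ := mulN zero v0 ≐ zero) (ρ := enil M)) => //; first exact: mul0.
move=> k h; rewrite -[sat _ _]/(mul zr (sc k) = zr) mulS add0l; exact: h.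
Qed.

Lemma mulSl m n : mul (sc m) n = add n (mul m n).
Proof.
apply: (qf_induction (φ := mulN (succ v1) v0 ≐ addN v0 (mulN v1 v0)) (ρ := env1 m)) => //.
  by rewrite -[sat _ _]/(mul (sc m) zr = add zr (mul m zr)) !mul0 add0.
move=> k h.
rewrite -[sat _ _]/(mul (sc m) (sc k) = add (sc k) (mul m (sc k))) !mulS.
have {}h : mul (sc m) k = add k (mul m k) := h.
by rewrite h !addSl addCA.
Qed.

Lemma mulC m n : mul m n = mul n m.
Proof.
apply: (qf_induction (φ := mulN v1 v0 ≐ mulN v0 v1) (ρ := env1 m)) => //.
  by rewrite -[sat _ _]/(mul m zr = mul zr m) mul0 mul0l.
move=> k h; rewrite -[sat _ _]/(mul m (sc k) = mul (sc k) m) mulS mulSl; congr add.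
exact: h.
Qed.

Lemma mulDr m n p : mul m (add n p) = add (mul m n) (mul m p).
Proof.
apply: (qf_induction (φ := mulN v1 (addN v2 v0) ≐ addN (mulN v1 v2) (mulN v1 v0))
  (ρ := env2 m n)) => //.
  by rewrite -[sat _ _]/(mul m (add n zr) = add (mul m n) (mul m zr)) mul0 !add0.
move=> k h.
rewrite -[sat _ _]/(mul m (add n (sc k)) = add (mul m n) (mul m (sc k))) addS !mulS.
have {}h : mul m (add n k) = add (mul m n) (mul m k) := h.
by rewrite h addCA.
Qed.

Lemma mulDl m n p : mul (add m n) p = add (mul m p) (mul n p).
Proof. by rewrite mulC mulDr !(mulC p). Qed.

Lemma mulA m n p : mul m (mul n p) = mul (mul m n) p.
Proof.
apply: (qf_induction (φ := mulN v1 (mulN v2 v0) ≐ mulN (mulN v1 v2) v0)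
  (ρ := env2 m n)) => //.
  by rewrite -[sat _ _]/(mul m (mul n zr) = mul (mul m n) zr) !mul0.
move=> k h; rewrite -[sat _ _]/(mul m (mul n (sc k)) = mul (mul m n) (sc k)) !mulS.
by rewrite mulDr; congr add; exact: h.
Qed.

Lemma mul1 m : mul m (sc zr) = m.
Proof. by rewrite mulS mul0 add0. Qed.

Lemma mnsSS m n : mns (sc m) (sc n) = mns m n.
Proof.
apply: (qf_induction (φ := monus (succ v1) (succ v0) ≐ monus v1 v0) (ρ := env1 m)) => //.
  by rewrite -[sat _ _]/(mns (sc m) (sc zr) = mns m zr) mnsS !mns0 prdS.
move=> k h; rewrite -[sat _ _]/(mns (sc m) (sc (sc k)) = mns m (sc k)) mnsS (mnsS m).
congr prd; exact: h.
Qed.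

Lemma addK m n : mns (add m n) n = m.
Proof.
apply: (qf_induction (φ := monus (addN v1 v0) v0 ≐ v1) (ρ := env1 m)) => //.
  by rewrite -[sat _ _]/(mns (add m zr) zr = m) mns0 add0.
move=> k h; rewrite -[sat _ _]/(mns (add m (sc k)) (sc k) = m) addS mnsSS; exact: h.
Qed.

Lemma addKl m n : mns (add m n) m = n.
Proof. by rewrite addC addK. Qed.

Lemma addI m n p : add m p = add n p -> m = n.
Proof. by move=> h; rewrite -(addK m p) h addK. Qed.

Lemma zr_or_sc n : n = zr \/ exists m, n = sc m.
Proof.
have : sat (v0 ≐ zero ⊔ v0 ≐ succ (predN v0)) (env1 n).
  apply: (qf_induction (φ := v0 ≐ zero ⊔ v0 ≐ succ (predN v0)) (ρ := enil M)) => //.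
    by left.
  by move=> k _; right; rewrite -[sat _ _]/(sc k = sc (prd (sc k))) prdS.
by move=> [h|h]; [left|right; exists (prd n)].
Qed.

Lemma add_eq0 m n : add m n = zr <-> m = zr /\ n = zr.
Proof.
split=> [|[-> ->]]; last exact: add0.
have [->|[k ->]] := zr_or_sc m; first by rewrite add0l.
by rewrite addSl => /sc_neq0.
Qed.

Lemma mul_eq0 m n : mul m n = zr <-> m = zr \/ n = zr.
Proof.
split=> [|[->|->]]; [|exact: mul0l|exact: mul0].
have [->|[k ->]] := zr_or_sc m; first by left.
have [->|[l ->]] := zr_or_sc n; first by right.
by rewrite mulS addSl => /sc_neq0.
Qed.

(** This is totality of the order. In the induction on [k], the side changes when [mns m k] is zero,
    that is, when [k] has reached [m]. *)
Lemma mns_cases m n : add m (mns n m) = n \/ add n (mns m n) = m.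
Proof.
apply: (qf_induction (φ := addN v1 (monus v0 v1) ≐ v0 ⊔ addN v0 (monus v1 v0) ≐ v1)
  (ρ := env1 m)) => //.
  by right; rewrite -[sat _ _]/(add zr (mns m zr) = m) mns0 add0l.
move=> k h.
have {}h : add m (mns k m) = k \/ add k (mns m k) = m := h.
rewrite -[sat _ _]/(add m (mns (sc k) m) = sc k \/ add (sc k) (mns m (sc k)) = m).
case: h => h.
  by left; have -> : sc k = add m (sc (mns k m)); [rewrite addS h|rewrite addKl].
have [e|[l e]] := zr_or_sc (mns m k).
  left; move: h; rewrite e add0 => ->.
  by have -> : sc m = add m (sc zr); [rewrite addS add0|rewrite addKl].
right; have -> : m = add (sc k) l by rewrite addSl -addS -e h.
by rewrite addKl.
Qed.

Lemma mns_eq0 m n : mns m n = zr <-> exists p, add m p = n.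
Proof.
split=> [h|[p <-]].
  have [e|] := mns_cases m n; first by exists (mns n m).
  by rewrite h add0 => ->; exists zr; rewrite add0.
apply: (qf_induction (φ := monus v1 (addN v1 v0) ≐ zero) (ρ := env1 m)) => //.
  by rewrite -[sat _ _]/(mns m (add m zr) = zr) add0 -{1}(add0l m) addK.
move=> k h; rewrite -[sat _ _]/(mns m (add m (sc k)) = zr) addS mnsS -prd0.
congr prd; exact: h.
Qed.

(** Expresses equality of numbers by the vanishing of one term, as the atomic case of [chi]
    requires. *)
Lemma eq_mns m n : add (mns m n) (mns n m) = zr <-> m = n.
Proof.
rewrite add_eq0; split=> [[h h']|->].
  by have [] := mns_cases m n; rewrite ?h ?h' add0.
by split; apply/mns_eq0; exists zr; rewrite add0.
Qed.

Definition on : dom M N := sc zr.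

Lemma mns1_eq0 m : mns on m = zr <-> m <> zr.
Proof.
have [->|[k ->]] := zr_or_sc m; first by rewrite mns0; split=> // /sc_neq0.
split=> _; first exact: sc_neq0.
by rewrite mnsSS; apply/mns_eq0; exists k; rewrite add0l.
Qed.

(** * Arithmetical comprehension, induction and choice *)

(** Only quantifiers are restricted to numbers. Free variables may have any type, so the sequence of
    open sets is allowed as a parameter. *)
Fixpoint arith Γ (φ : fm Γ) : Prop :=
  match φ with
  | Eq _ _ _ | Bot _ => True
  | Imp _ φ ψ | And _ φ ψ | Or _ φ ψ => arith φ /\ arith ψ
  | All _ σ φ | Ex _ σ φ => σ = N /\ arith φ
  end.

Lemma arith_sub Γ (φ : fm Γ) Δ (s : sub Γ Δ) : arith φ -> arith (sub_fm φ s).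
Proof.
elim: φ Δ s => {Γ} //=.
- by move=> Γ φ IH ψ IH' Δ s [/IH h /IH' h'].
- by move=> Γ φ IH ψ IH' Δ s [/IH h /IH' h'].
- by move=> Γ φ IH ψ IH' Δ s [/IH h /IH' h'].
- by move=> Γ σ φ IH Δ s [? /IH h].
- by move=> Γ σ φ IH Δ s [? /IH h].
Qed.

(* With [e] denoting ∃², [chi φ e] vanishes exactly when [φ] holds; quantifiers
   over types other than [N] get a junk value. *)
Fixpoint chi Γ (φ : fm Γ) : tm Γ (B ⇒ N) -> tm Γ N :=
  match φ with
  | Eq _ t u => fun _ => addN (monus t u) (monus u t)
  | Bot _ => fun _ => one
  | Imp _ φ ψ => fun e => mulN (monus one (chi φ e)) (chi ψ e)
  | And _ φ ψ => fun e => addN (chi φ e) (chi ψ e)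
  | Or _ φ ψ => fun e => mulN (chi φ e) (chi ψ e)
  | All Γ σ φ => fun e =>
      match σ return tm (σ :: Γ) N -> tm Γ N with
      | N => fun c => monus one (e ⋅ lam (monus one c))
      | _ => fun _ => zero
      end (chi φ (wk e))
  | Ex Γ σ φ => fun e =>
      match σ return tm (σ :: Γ) N -> tm Γ N with
      | N => fun c => e ⋅ lam c
      | _ => fun _ => zero
      end (chi φ (wk e))
  end.

Lemma exists2_ex :
  exists E : dom M (B ⇒ N), forall f, E ∙ f = zr <-> exists n, f ∙ n = zr.
Proof.
have [E h] := M_models (enil M) (ACA0w_QFAC01_base (ax_exists2 [])).
by exists E => f; have [_ [h1 h2]] := h f; split.
Qed.

Definition E2 : dom M (B ⇒ N) := sval (cid exists2_ex).

Lemma E2P f : E2 ∙ f = zr <-> exists n, f ∙ n = zr.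
Proof. exact: (svalP (cid exists2_ex)). Qed.

Lemma chiP Γ (φ : fm Γ) (ρ : env M Γ) (e : tm Γ (B ⇒ N)) :
  arith φ -> eval e ρ = E2 -> (eval (chi φ e) ρ = zr <-> sat φ ρ).
Proof.
elim: φ ρ e => {Γ}.
- move=> Γ t u ρ e _ _.
  rewrite -[eval _ _]/(add (mns (eval t ρ) (eval u ρ)) (mns (eval u ρ) (eval t ρ))).
  by rewrite eq_mns.
- by move=> Γ ρ e _ _; split=> // /sc_neq0.
- move=> Γ φ IH ψ IH' ρ e /= [aφ aψ] eE.
  rewrite -/(mul (mns on (eval (chi φ e) ρ)) (eval (chi ψ e) ρ)).
  rewrite mul_eq0 mns1_eq0 IH // IH' //; split=> [[//|//]|h].
  by have [/h|] := pselect (sat φ ρ); [right|left].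
- move=> Γ φ IH ψ IH' ρ e /= [aφ aψ] eE.
  by rewrite -/(add (eval (chi φ e) ρ) (eval (chi ψ e) ρ)) add_eq0 IH // IH'.
- move=> Γ φ IH ψ IH' ρ e /= [aφ aψ] eE.
  by rewrite -/(mul (eval (chi φ e) ρ) (eval (chi ψ e) ρ)) mul_eq0 IH // IH'.
- move=> Γ σ φ IH ρ e [e1 aφ] eE; subst σ; rewrite sat_All.
  rewrite -[eval _ _]/(mns on (eval e ρ ∙ eval (lam (monus one (chi φ (wk e)))) ρ)).
  rewrite eE mns1_eq0 E2P.
  have h a : eval (lam (monus one (chi φ (wk e)))) ρ ∙ a = zr <-> ~ sat φ (econs a ρ).
    rewrite eval_lam -[eval _ _]/(mns on (eval (chi φ (wk e)) (econs a ρ))) mns1_eq0.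
    by rewrite IH // eval_wk.
  split=> [hn a|ha [a /h]]; last by apply; apply: ha.
  by apply: contrapT => /h ha; apply: hn; exists a.
- move=> Γ σ φ IH ρ e [e1 aφ] eE; subst σ; rewrite sat_Ex.
  rewrite -[eval _ _]/(eval e ρ ∙ eval (lam (chi φ (wk e))) ρ) eE E2P.
  by split=> -[a]; rewrite ?eval_lam => h; exists a; move: h;
    rewrite ?eval_lam IH // eval_wk.
Qed.

(** [E2] is an element of the model and not a term of the language, so [chi] receives it as an
    additional variable, which the comprehension lemmas abstract and then instantiate. *)
Lemma arith_term Γ (φ : fm Γ) : arith φ ->
  exists c : tm ((B ⇒ N) :: Γ) N, forall ρ, eval c (econs E2 ρ) = zr <-> sat φ ρ.
Proof.
move=> aφ; exists (chi (wk_fm φ) v0) => ρ.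
rewrite chiP //; first exact: sat_wk_fm.
exact: arith_sub.
Qed.

Lemma arith_comprehension Γ σ (φ : fm (σ :: Γ)) (ρ : env M Γ) : arith φ ->
  exists f : dom M (σ ⇒ N), forall a, f ∙ a = zr <-> sat φ (econs a ρ).
Proof.
move=> /arith_term[c cP].
pose F := eval (lam (lam c)) ρ.
exists (eval (lam (v1 ⋅ v0 ⋅ v2)) (econs F (econs E2 (enil M)))) => a.
by rewrite eval_lam -cP -[eval (_ ⋅ _) _]/(F ∙ a ∙ E2) /F !eval_lam.
Qed.

Lemma arith_comprehension2 Γ σ τ (φ : fm (σ :: τ :: Γ)) (ρ : env M Γ) : arith φ ->
  exists f : dom M (σ ⇒ τ ⇒ N),
    forall a b, f ∙ a ∙ b = zr <-> sat φ (econs a (econs b ρ)).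
Proof.
move=> /arith_term[c cP].
pose F := eval (lam (lam (lam c))) ρ.
exists (eval (lam (lam (v2 ⋅ v0 ⋅ v1 ⋅ v3)))  (econs F (econs E2 (enil M)))) => a b.
by rewrite !eval_lam -cP -[eval (_ ⋅ _) _]/(F ∙ b ∙ a ∙ E2) /F !eval_lam.
Qed.

(** Comprehension replaces the formula by [f n = 0] with [f] a parameter, which is
    quantifier-free. *)
Lemma arith_induction Γ (φ : fm (N :: Γ)) (ρ : env M Γ) : arith φ ->
  sat φ (econs zr ρ) ->
  (forall n, sat φ (econs n ρ) -> sat φ (econs (sc n) ρ)) ->
  forall n, sat φ (econs n ρ).
Proof.
move=> /(arith_comprehension ρ)[f fP] h0 hS n; apply/fP; move: n.
apply: (qf_induction (φ := v1 ⋅ v0 ≐ zero) (ρ := econs f (enil M))) => //.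
  exact/fP.
by move=> n /fP/hS/fP.
Qed.

Lemma arith_choice Γ (φ : fm (B :: N :: Γ)) (ρ : env M Γ) : arith φ ->
  (forall n, exists f, sat φ (econs f (econs n ρ))) ->
  exists F : dom M (N ⇒ B), forall n, sat φ (econs (F ∙ n) (econs n ρ)).
Proof.
move=> /(arith_comprehension2 ρ)[Y YP] h.
have ac := M_models (enil M) (ax_qfac01 []).
have [|F FP] := ac Y; first by move=> n; have [f /YP hf] := h n; exists f.
by exists F => n; apply/YP; apply: FP.
Qed.

End Arithmetic.

(** * The ordered field of fractions of a cancellative semiring *)

Section FieldEmbedding.
Import Order.TTheory GRing.Theory Num.Theory.
Local Open Scope ring_scope.
Local Open Scope quotient_scope.

Variable A : comNzSemiRingType.
Implicit Types a b c d : A.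
Hypothesis addIA : forall a b c, a + c = b + c -> a = b.
Hypothesis totalA : forall a b, exists c, a + c = b \/ b + c = a.
Hypothesis addA_eq0 : forall a b, a + b = 0 -> a = 0.
Hypothesis mulA_eq0 : forall a b, a * b = 0 -> a = 0 \/ b = 0.

(** * The ring of differences *)

Definition difrel (p q : A * A) : bool := p.1 + q.2 == q.1 + p.2.

Lemma difrel_refl : reflexive difrel.
Proof. by move=> p; apply/eqP. Qed.

Lemma difrel_sym : symmetric difrel.
Proof. by move=> p q; rewrite /difrel eq_sym. Qed.

Lemma difrel_trans : transitive difrel.
Proof.
move=> [c d] [a b] [e f] /eqP/= h /eqP/= h'; apply/eqP/(addIA (c := d)) => /=.
have -> : a + f + d = (a + d) + f by ring.
by rewrite h addrAC h'; ring.
Qed.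

Canonical difrel_equiv := EquivRel difrel difrel_refl difrel_sym difrel_trans.

Definition dif := {eq_quot difrel}.
HB.instance Definition _ : EqQuotient _ difrel dif := EqQuotient.on dif.
HB.instance Definition _ := Choice.on dif.

Lemma dif_eqP (p q : A * A) : \pi_dif p = \pi_dif q <-> p.1 + q.2 = q.1 + p.2.
Proof. by split=> [/eqmodP/eqP|h]; last by apply/eqmodP/eqP. Qed.

Lemma dif_reprP (p : A * A) :
  p.1 + (repr (\pi_dif p)).2 = (repr (\pi_dif p)).1 + p.2.
Proof. by apply/dif_eqP; rewrite reprK. Qed.

Definition dif_add (x y : dif) : dif :=
  \pi_dif ((repr x).1 + (repr y).1, (repr x).2 + (repr y).2).
Definition dif_opp (x : dif) : dif := \pi_dif ((repr x).2, (repr x).1).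
Definition dif_mul (x y : dif) : dif :=
  \pi_dif ((repr x).1 * (repr y).1 + (repr x).2 * (repr y).2,
       (repr x).1 * (repr y).2 + (repr x).2 * (repr y).1).
Definition dif_of (a : A) : dif := \pi_dif (a, 0).

Lemma pi_dif_add p q :
  dif_add (\pi_dif p) (\pi_dif q) = \pi_dif (p.1 + q.1, p.2 + q.2).
Proof.
rewrite /dif_add; apply/dif_eqP; have := dif_reprP p; have := dif_reprP q.
move: (repr (\pi_dif p)) (repr (\pi_dif q)) => p' q' hq hp /=.
have -> : p'.1 + q'.1 + (p.2 + q.2) = (p'.1 + p.2) + (q'.1 + q.2) by ring.
by rewrite -hp -hq; ring.
Qed.

Lemma pi_dif_opp p : dif_opp (\pi_dif p) = \pi_dif (p.2, p.1).
Proof.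
by rewrite /dif_opp; apply/dif_eqP; rewrite /= addrC (dif_reprP p) addrC.
Qed.

Lemma pi_dif_mul p q :
  dif_mul (\pi_dif p) (\pi_dif q) =
  \pi_dif (p.1 * q.1 + p.2 * q.2, p.1 * q.2 + p.2 * q.1).
Proof.
have := dif_reprP p; have := dif_reprP q; rewrite /dif_mul.
move: (repr (\pi_dif p)) (repr (\pi_dif q)) => q' p' hq hp.
(* One factor is replaced by its representative at a time, which keeps each identity linear in the
   relation used. *)
transitivity (\pi_dif (p.1 * p'.1 + p.2 * p'.2, p.1 * p'.2 + p.2 * p'.1)).
  apply/dif_eqP => /=.
  have -> : q'.1 * p'.1 + q'.2 * p'.2 + (p.1 * p'.2 + p.2 * p'.1) =
    (q'.1 + p.2) * p'.1 + (p.1 + q'.2) * p'.2 by ring.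
  by rewrite -hp {2}hp; ring.
apply/dif_eqP => /=.
have -> : p.1 * p'.1 + p.2 * p'.2 + (p.1 * q.2 + p.2 * q.1) =
  p.1 * (p'.1 + q.2) + p.2 * (q.1 + p'.2) by ring.
by rewrite -hq {2}hq; ring.
Qed.

Lemma dif_addA : associative dif_add.
Proof.
elim/quotW=> x; elim/quotW=> y; elim/quotW=> z.
rewrite (pi_dif_add y z) (pi_dif_add x) (pi_dif_add x y) (pi_dif_add _ z) /=.
by rewrite !addrA.
Qed.

Lemma dif_addC : commutative dif_add.
Proof. by elim/quotW=> x; elim/quotW=> y; rewrite !pi_dif_add addrC (addrC x.2). Qed.

Lemma dif_add0 : left_id (dif_of 0) dif_add.
Proof. by elim/quotW=> -[a b]; rewrite pi_dif_add /= !add0r. Qed.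

Lemma dif_addN : left_inverse (dif_of 0) dif_opp dif_add.
Proof.
elim/quotW=> x; rewrite pi_dif_opp pi_dif_add; apply/dif_eqP => /=.
by rewrite addr0 add0r addrC.
Qed.

HB.instance Definition _ :=
  GRing.isZmodule.Build dif dif_addA dif_addC dif_add0 dif_addN.

Lemma dif_mulA : associative dif_mul.
Proof.
elim/quotW=> x; elim/quotW=> y; elim/quotW=> z.
rewrite (pi_dif_mul y z) (pi_dif_mul x) (pi_dif_mul x y) (pi_dif_mul _ z) /=.
by apply: (congr1 \pi_dif); congr pair; ring.
Qed.

Lemma dif_mulC : commutative dif_mul.
Proof.
elim/quotW=> x; elim/quotW=> y.
by rewrite !pi_dif_mul /=; apply: (congr1 \pi_dif); congr pair; ring.
Qed.

Lemma dif_mul1 : left_id (dif_of 1) dif_mul.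
Proof. by elim/quotW=> -[a b]; rewrite pi_dif_mul /= !mul1r !mul0r !addr0. Qed.

Lemma dif_mulD : left_distributive dif_mul dif_add.
Proof.
elim/quotW=> x; elim/quotW=> y; elim/quotW=> z.
rewrite (pi_dif_add x y) (pi_dif_mul _ z) (pi_dif_mul x z) (pi_dif_mul y z).
by rewrite pi_dif_add; apply: (congr1 \pi_dif); congr pair; rewrite /=; ring.
Qed.

Lemma dif_1_neq0 : dif_of 1 != dif_of 0.
Proof. by apply/eqP => /dif_eqP /= /eqP; rewrite !addr0 oner_eq0. Qed.

HB.instance Definition _ :=
  GRing.Zmodule_isComNzRing.Build dif dif_mulA dif_mulC dif_mul1 dif_mulD dif_1_neq0.

(** The fraction field is built over an integral domain structure that includes an inverse
    operation; here units and inverses are chosen classically. *)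
Definition dif_unit : {pred dif} := fun x => `[< exists y, y * x = 1 >].
Definition dif_inv (x : dif) : dif :=
  if pselect (exists y, y * x = 1) is left h then sval (cid h) else x.

Lemma dif_mulV : {in dif_unit, left_inverse 1 dif_inv *%R}.
Proof. by move=> x /asboolP h; rewrite /dif_inv; case: pselect => // h'; case: cid. Qed.

Lemma dif_unitP (x y : dif) : y * x = 1 -> dif_unit x.
Proof. by move=> h; apply/asboolP; exists y. Qed.

Lemma dif_inv_out : {in [predC dif_unit], dif_inv =1 id}.
Proof. by move=> x /asboolP h; rewrite /dif_inv; case: pselect. Qed.

HB.instance Definition _ :=
  GRing.ComNzRing_hasMulInverse.Build dif dif_mulV dif_unitP dif_inv_out.

(** Totality of the order on [A] gives every difference a sign. This reduces absence of zero
    divisors, and later the sign of a fraction, to [A]. *)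
Lemma difP (x : dif) : exists a, x = dif_of a \/ x = - dif_of a.
Proof.
elim/quotW: x => -[a b]; have [c [<-|<-]] := totalA a b; exists c.
  right; rewrite [RHS]pi_dif_opp; apply/dif_eqP => /=; by rewrite add0r.
by left; apply/dif_eqP => /=; rewrite addr0 addrC.
Qed.

Lemma dif_ofD a b : dif_of (a + b) = dif_of a + dif_of b.
Proof. by rewrite [RHS]pi_dif_add /= addr0. Qed.

Lemma dif_ofM a b : dif_of (a * b) = dif_of a * dif_of b.
Proof. by rewrite [RHS]pi_dif_mul /= !mulr0 mul0r !addr0. Qed.

Lemma dif_of_inj : injective dif_of.
Proof. by move=> a b /dif_eqP /=; rewrite !addr0. Qed.

Lemma dif_of_eq0 a : dif_of a = 0 -> a = 0.
Proof. exact: dif_of_inj. Qed.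

Lemma dif_idomain (x y : dif) : x * y = 0 -> (x == 0) || (y == 0).
Proof.
have [a ha] := difP x; have [b hb] := difP y => xy0.
have /dif_of_eq0/mulA_eq0 h : dif_of (a * b) = 0.
  rewrite dif_ofM; case: ha hb xy0 => -> [] ->; rewrite ?mulNr ?mulrN ?opprK //.
    by move/eqP; rewrite oppr_eq0 => /eqP.
  by move/eqP; rewrite oppr_eq0 => /eqP.
apply/orP; case: h => h; [left|right].
  by case: ha => ->; rewrite h -[dif_of 0]/(0 : dif) ?oppr0.
by case: hb => ->; rewrite h -[dif_of 0]/(0 : dif) ?oppr0.
Qed.

HB.instance Definition _ := GRing.ComUnitRing_isIntegral.Build dif dif_idomain.

Local Notation "x %:F" := (FracField.tofrac x).

(** * The fraction field and its order *)

Definition frac_of (a : A) : {fraction dif} := (dif_of a)%:F.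

Lemma frac_ofD a b : frac_of (a + b) = frac_of a + frac_of b.
Proof. by rewrite /frac_of dif_ofD rmorphD. Qed.

Lemma frac_ofM a b : frac_of (a * b) = frac_of a * frac_of b.
Proof. by rewrite /frac_of dif_ofM rmorphM. Qed.

Lemma frac_of0 : frac_of 0 = 0. Proof. exact: tofrac0. Qed.
Lemma frac_of1 : frac_of 1 = 1. Proof. exact: tofrac1. Qed.

Lemma frac_of_inj : injective frac_of.
Proof. by move=> a b /eqP; rewrite tofrac_eq => /eqP/dif_of_inj. Qed.

Lemma frac_of_neq0 a : a != 0 -> frac_of a != 0.
Proof. by apply: contra_neq => h; apply: frac_of_inj; rewrite frac_of0. Qed.

(** The positive cone: closed under sums and products because [A] is, and total up to sign by
    [difP]. *)
Definition frac_ge0 (x : {fraction dif}) : Prop :=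
  exists a b, b != 0 /\ x = frac_of a / frac_of b.

Lemma frac_ge0_total x : frac_ge0 x \/ frac_ge0 (- x).
Proof.
(* A fraction is a class of pairs, so the embedding must be unfolded to see it as a quotient of
   embedded differences. *)
have [n [d [d0 ->]]] : exists n d : dif, d != 0 /\ x = n%:F / d%:F.
  elim/quotW: x => r; exists \n_r, \d_r; split; first exact: denom_ratioP.
  have d0 : (\d_r)%:F != 0 :> {fraction dif} by rewrite tofrac_eq0 denom_ratioP.
  apply: (mulIf d0); rewrite divfK //.
  unlock FracField.tofrac.
  rewrite -[LHS]FracField.pi_mul; apply/eqmodP => /=.
  rewrite /FracField.mulf FracField.equivfE !numden_Ratio ?mulf_neq0 ?oner_eq0 ?denom_ratioP //.
  by apply/eqP; ring.
have [a ha] := difP n; have [b hb] := difP d.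
have b0 : b != 0.
  by apply: contra_neq d0 => e; case: hb => ->; rewrite e -[dif_of 0]/(0 : dif) ?oppr0.
have ge0 : frac_ge0 (frac_of a / frac_of b) by exists a, b.
by case: ha hb => -> [] ->; rewrite ?rmorphN ?mulNr ?invrN ?mulrN ?opprK; auto.
Qed.

Lemma frac_ge0D x y : frac_ge0 x -> frac_ge0 y -> frac_ge0 (x + y).
Proof.
move=> [a [b [b0 ->]]] [c [d [d0 ->]]]; exists (a * d + c * b), (b * d).
have bd : b * d != 0 by apply/eqP => /mulA_eq0[] /eqP; rewrite ?(negbTE b0) ?(negbTE d0).
split=> //; rewrite addf_div ?frac_of_neq0 //.
by rewrite -!frac_ofM -frac_ofD.
Qed.

Lemma frac_ge0M x y : frac_ge0 x -> frac_ge0 y -> frac_ge0 (x * y).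
Proof.
move=> [a [b [b0 ->]]] [c [d [d0 ->]]]; exists (a * c), (b * d).
have bd : b * d != 0 by apply/eqP => /mulA_eq0[] /eqP; rewrite ?(negbTE b0) ?(negbTE d0).
by split=> //; rewrite mulf_div -!frac_ofM.
Qed.

(** Clearing denominators turns the vanishing sum into [a * d + c * b = 0] in [A], where a sum
    vanishes only if its terms do. *)
Lemma frac_ge0_anti x : frac_ge0 x -> frac_ge0 (- x) -> x = 0.
Proof.
move=> [a [b [b0 ->]]] [c [d [d0 e]]].
have : frac_of a / frac_of b + frac_of c / frac_of d = 0 by rewrite -e subrr.
have bd : b * d != 0 by apply/eqP => /mulA_eq0[] /eqP; rewrite ?(negbTE b0) ?(negbTE d0).
rewrite addf_div ?frac_of_neq0 // -!frac_ofM -frac_ofD => /eqP.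
rewrite mulf_eq0 invr_eq0 (negbTE (frac_of_neq0 bd)) orbF => /eqP.
rewrite -frac_of0 => /frac_of_inj/addA_eq0/mulA_eq0[->|/eqP].
  by rewrite frac_of0 mul0r.
by rewrite (negbTE d0).
Qed.

Definition frac_le (x y : {fraction dif}) : bool := `[< frac_ge0 (y - x) >].
Definition frac_lt (x y : {fraction dif}) : bool := (y != x) && frac_le x y.
Definition frac_norm (x : {fraction dif}) : {fraction dif} :=
  if `[< frac_ge0 x >] then x else - x.

Lemma frac_le0 x : frac_le 0 x = `[< frac_ge0 x >].
Proof. by rewrite /frac_le subr0. Qed.

Lemma frac_le_0 x : frac_le x 0 = `[< frac_ge0 (- x) >].
Proof. by rewrite /frac_le sub0r. Qed.

Lemma frac_le0D x y : frac_le 0 x -> frac_le 0 y -> frac_le 0 (x + y).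
Proof. by rewrite !frac_le0 => /asboolP h /asboolP h'; apply/asboolP/frac_ge0D. Qed.

Lemma frac_le0M x y : frac_le 0 x -> frac_le 0 y -> frac_le 0 (x * y).
Proof. by rewrite !frac_le0 => /asboolP h /asboolP h'; apply/asboolP/frac_ge0M. Qed.

Lemma frac_le0_anti x : frac_le 0 x -> frac_le x 0 -> x = 0.
Proof. by rewrite frac_le0 frac_le_0 => /asboolP h /asboolP h'; apply: frac_ge0_anti. Qed.

Lemma frac_sub_ge0 x y : frac_le 0 (y - x) = frac_le x y.
Proof. by rewrite frac_le0. Qed.

Lemma frac_le0_total x : frac_le 0 x || frac_le x 0.
Proof.
rewrite frac_le0 frac_le_0; apply/orP.
by have [h|h] := frac_ge0_total x; [left|right]; apply/asboolP.
Qed.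

Lemma frac_normN x : frac_norm (- x) = frac_norm x.
Proof.
rewrite /frac_norm; case: asboolP => h; case: asboolP => h'; rewrite ?opprK //.
  by rewrite (frac_ge0_anti h' h) oppr0.
by case: (frac_ge0_total x).
Qed.

Lemma frac_ge0_norm x : frac_le 0 x -> frac_norm x = x.
Proof. by rewrite frac_le0 /frac_norm => ->. Qed.

Lemma frac_lt_def x y : frac_lt x y = (y != x) && frac_le x y.
Proof. by []. Qed.

Definition frac_real := Num.IntegralDomain_isLeReal.Build {fraction dif}
  frac_le0D frac_le0M frac_le0_anti frac_sub_ge0 frac_le0_total frac_normN
  frac_ge0_norm frac_lt_def.

Lemma ordered_field_embedding : exists (F : realFieldType) (f : A -> F),
  [/\ (forall a b, f (a + b) = f a + f b), (forall a b, f (a * b) = f a * f b),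
      f 0 = 0, f 1 = 1 & (forall a, 0 <= f a) /\ injective f].
Proof.
pose F : realFieldType := HB.pack {fraction dif} frac_real.
exists F, frac_of; split.
- exact: frac_ofD.
- exact: frac_ofM.
- exact: frac_of0.
- exact: frac_of1.
- split; last exact: frac_of_inj.
  move=> a; suff h : frac_le 0 (frac_of a) by exact: h.
  by rewrite frac_le0; apply/asboolP; exists a, 1; rewrite oner_neq0 frac_of1 divr1.
Qed.

End FieldEmbedding.

(** * Rationals and reals in a model *)

Lemma sat_Imp M Γ (φ ψ : fm Γ) (ρ : env M Γ) : sat (φ ⊃ ψ) ρ <-> (sat φ ρ -> sat ψ ρ).
Proof. by []. Qed.

Lemma sat_And M Γ (φ ψ : fm Γ) (ρ : env M Γ) : sat (φ ⊓ ψ) ρ <-> sat φ ρ /\ sat ψ ρ.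
Proof. by []. Qed.

Lemma sat_Or M Γ (φ ψ : fm Γ) (ρ : env M Γ) : sat (φ ⊔ ψ) ρ <-> sat φ ρ \/ sat ψ ρ.
Proof. by []. Qed.

Lemma sat_Neg M Γ (φ : fm Γ) (ρ : env M Γ) : sat (Neg φ) ρ <-> ~ sat φ ρ.
Proof. by []. Qed.

Section Reals.
Import Order.TTheory GRing.Theory Num.Theory.
Local Open Scope ring_scope.

Variable M : model.
Hypothesis M_models : models M ACA0w_QFAC01.
Hypothesis M_ext :
  forall σ τ (f g : dom M (σ ⇒ τ)), (forall a, ap f a = ap g a) -> f = g.

Local Notation "f ∙ a" := (ap f a) (at level 40, left associativity).
Local Notation zr := (zr M).
Local Notation on := (on M).

Lemma nat_embedding : exists (F : realFieldType) (ι : dom M N -> F),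
  [/\ (forall a b, ι (add a b) = ι a + ι b), (forall a b, ι (mul a b) = ι a * ι b),
      ι zr = 0, ι on = 1 & (forall a, 0 <= ι a) /\ injective ι].
Proof.
pose A0 : choiceType :=
  HB.pack (dom M N) (gen_eqMixin (dom M N)) (gen_choiceMixin (dom M N)).
have on_neq0 : (on : A0) != zr by apply/eqP => /(sc_neq0 M_models).
have mul1l : left_id on (@mul M) by move=> a; rewrite mulC // mul1.
pose A1 : nmodType := HB.pack A0
  (GRing.isNmodule.Build A0 (@addA M M_models M_ext) (@addC M M_models M_ext)
     (@add0l M M_models M_ext)).
pose A : comNzSemiRingType := HB.pack A1
  (GRing.Nmodule_isComNzSemiRing.Build A1 (@mulA M M_models M_ext)
     (@mulC M M_models M_ext) mul1l
     (fun a b c => @mulDl M M_models M_ext a b c) (@mul0l M M_models M_ext) on_neq0).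
apply: (@ordered_field_embedding A).
- exact: addI.
- by move=> a b; have [h|h] := mns_cases M_models M_ext a b;
    [exists (mns b a); left|exists (mns a b); right].
- by move=> a b /(add_eq0 M_models M_ext)[].
- by move=> a b /(mul_eq0 M_models M_ext).
Qed.

Variables (F : realFieldType) (ι : dom M N -> F).
Hypothesis ιD : forall a b, ι (add a b) = ι a + ι b.
Hypothesis ιM : forall a b, ι (mul a b) = ι a * ι b.
Hypothesis ι0 : ι zr = 0.
Hypothesis ι1 : ι on = 1.
Hypothesis ι_ge0 : forall a, 0 <= ι a.
Hypothesis ι_inj : injective ι.

Lemma ιS n : ι (sc n) = ι n + 1.
Proof. by rewrite -ι1 -ιD addS // add0. Qed.

Lemma mns_eq0_le m n : mns m n = zr <-> ι m <= ι n.
Proof.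
rewrite mns_eq0 //; split=> [[p <-]|h]; first by rewrite ιD; have := ι_ge0 p; lra.
have [e|e] := mns_cases M_models M_ext m n; first by exists (mns n m).
exists zr; rewrite add0 //; apply: ι_inj; apply: le_anti; rewrite h -e ιD.
by have := ι_ge0 (mns m n); lra.
Qed.

(** Discreteness: a nonzero difference is a successor, hence at least one. *)
Lemma ι_ltS m n : (ι m < ι n) = (ι (sc m) <= ι n).
Proof.
apply/idP/idP => [h|]; last by rewrite ιS; lra.
have /mns_eq0_le := ltW h; rewrite mns_eq0 // => -[p e]; move: h; rewrite -e.
have [->|[q ->]] := zr_or_sc M_models M_ext p; first by rewrite add0 // ltxx.
by rewrite ιD !ιS; have := ι_ge0 q; lra.
Qed.

Lemma mns_eq0_lt m n : mns (sc m) n = zr <-> ι m < ι n.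
Proof. by rewrite mns_eq0_le ι_ltS. Qed.

Lemma ι_mns m n : ι n <= ι m -> ι (mns m n) = ι m - ι n.
Proof.
move=> /mns_eq0_le; rewrite mns_eq0 // => -[p <-].
by rewrite addKl // ιD; lra.
Qed.

(** * Powers of two, triangular numbers and the Cantor pairing *)

Definition pw (n : dom M N) : dom M N := eval (pow2 v0) (env1 n).
Definition tr (n : dom M N) : dom M N := eval (tri v0) (env1 n).
Definition rt (p : dom M N) : dom M N := eval (root v0) (env1 p).
Definition pr m n : dom M N := add (tr (add m n)) n.
Definition sn p : dom M N := mns p (tr (rt p)).
Definition fs p : dom M N := mns (rt p) (sn p).

Lemma eval_addN Γ (t u : tm Γ N) (ρ : env M Γ) :
  eval (addN t u) ρ = add (eval t ρ) (eval u ρ). Proof. by []. Qed.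
Lemma eval_mulN Γ (t u : tm Γ N) (ρ : env M Γ) :
  eval (mulN t u) ρ = mul (eval t ρ) (eval u ρ). Proof. by []. Qed.
Lemma eval_monus Γ (t u : tm Γ N) (ρ : env M Γ) :
  eval (monus t u) ρ = mns (eval t ρ) (eval u ρ). Proof. by []. Qed.
Lemma eval_predN Γ (t : tm Γ N) (ρ : env M Γ) :
  eval (predN t) ρ = prd (eval t ρ). Proof. by []. Qed.
Lemma eval_succ Γ (t : tm Γ N) (ρ : env M Γ) :
  eval (succ t) ρ = sc (eval t ρ). Proof. by []. Qed.
Lemma eval_zero Γ (ρ : env M Γ) : eval zero ρ = zr. Proof. by []. Qed.
Lemma eval_pow2 Γ (t : tm Γ N) (ρ : env M Γ) :
  eval (pow2 t) ρ = pw (eval t ρ). Proof. by []. Qed.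
Lemma eval_tri Γ (t : tm Γ N) (ρ : env M Γ) :
  eval (tri t) ρ = tr (eval t ρ). Proof. by []. Qed.
Lemma eval_root Γ (t : tm Γ N) (ρ : env M Γ) :
  eval (root t) ρ = rt (eval t ρ). Proof. by []. Qed.
Lemma eval_pairN Γ (t u : tm Γ N) (ρ : env M Γ) :
  eval (pairN t u) ρ = pr (eval t ρ) (eval u ρ). Proof. by []. Qed.
Lemma eval_sndN Γ (t : tm Γ N) (ρ : env M Γ) :
  eval (sndN t) ρ = sn (eval t ρ). Proof. by []. Qed.
Lemma eval_fstN Γ (t : tm Γ N) (ρ : env M Γ) :
  eval (fstN t) ρ = fs (eval t ρ). Proof. by []. Qed.
Lemma eval_App Γ σ τ (t : tm Γ (σ ⇒ τ)) u (ρ : env M Γ) :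
  eval (t ⋅ u) ρ = eval t ρ ∙ eval u ρ. Proof. by []. Qed.

Definition evalN := (eval_addN, eval_mulN, eval_monus, eval_predN, eval_succ,
  eval_zero, eval_pow2, eval_tri, eval_root, eval_pairN, eval_sndN, eval_fstN).

Lemma pw0 : pw zr = on. Proof. exact: rec0. Qed.

Lemma pwS n : pw (sc n) = add (pw n) (pw n).
Proof.
have e m : pw m = icst M cRec ∙ eval (lam (lam (addN v0 v0))) (enil M) ∙ on ∙ m by [].
by rewrite !e recS // eval_lam // eval_lam.
Qed.

Lemma tr0 : tr zr = zr. Proof. exact: rec0. Qed.

Lemma trS n : tr (sc n) = add (tr n) (sc n).
Proof.
have e m : tr m =
  icst M cRec ∙ eval (lam (lam (addN v0 (succ v1)))) (enil M) ∙ zr ∙ m by [].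
by rewrite !e recS // eval_lam // eval_lam.
Qed.

Lemma rt0 : rt zr = zr. Proof. exact: rec0. Qed.

Lemma rtS p : rt (sc p) = add (rt p) (mns on (mns (tr (sc (rt p))) (sc p))).
Proof.
have e m : rt m = icst M cRec ∙
  eval (lam (lam (addN v0 (monus one (monus (tri (succ v0)) (succ v1)))))) (enil M)
  ∙ zr ∙ m by [].
by rewrite !e recS // eval_lam // eval_lam.
Qed.

Lemma ι_tr n : ι (tr n) *+ 2 = ι n * (ι n + 1).
Proof.
suff : add (tr n) (tr n) = mul n (sc n).
  by move=> /(congr1 ι); rewrite ιD ιM ιS mulr2n.
apply: (qf_induction M_models (φ := addN (tri v0) (tri v0) ≐ mulN v0 (succ v0))
  (ρ := enil M)) => //.
  by rewrite -[sat _ _]/(add (tr zr) (tr zr) = mul zr (sc zr)) tr0 add0 // mul0l.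
move=> k; rewrite -[sat _ _]/(add (tr k) (tr k) = mul k (sc k)).
rewrite -[sat _ (econs (sc k) _)]/(add (tr (sc k)) (tr (sc k)) = mul (sc k) (sc (sc k))).
move=> /(congr1 ι) h; apply: ι_inj; move: h.
by rewrite trS !(ιD, ιM, ιS) => h; nra.
Qed.

(** When [p] grows by one it passes at most one triangular number, so the root has to advance by at
    most one. *)
Lemma rtP p : ι (tr (rt p)) <= ι p < ι (tr (sc (rt p))).
Proof.
have : sat (leN (tri (root v0)) v0 ⊓ ltN v0 (tri (succ (root v0)))) (env1 p).
  apply: (qf_induction M_models (ρ := enil M)) => //.
    split.
      by rewrite -[sat _ _]/(mns (tr (rt zr)) zr = zr) rt0 tr0 mns0.
    rewrite -[sat _ _]/(mns (sc zr) (tr (sc (rt zr))) = zr) rt0 mns_eq0_lt trS ιD ιS.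
    by rewrite tr0 ι0; lra.
  move=> k; rewrite sat_And.
  rewrite -[sat _ (econs k _)]/(mns (tr (rt k)) k = zr) mns_eq0_le.
  rewrite -[sat (ltN _ _) _]/(mns (sc k) (tr (sc (rt k))) = zr) mns_eq0_lt.
  move=> [h1 h2]; rewrite sat_And.
  rewrite -[sat _ (econs (sc k) _)]/(mns (tr (rt (sc k))) (sc k) = zr) mns_eq0_le.
  rewrite -[sat (ltN _ _) _]/(mns (sc (sc k)) (tr (sc (rt (sc k)))) = zr) mns_eq0_lt.
  rewrite rtS; have [e|e] := pselect (mns (tr (sc (rt k))) (sc k) = zr).
    rewrite e mns0 //; move/mns_eq0_le: e; rewrite /on addS // add0 // => e; split=> //.
    move: h2; rewrite ι_ltS => h2; rewrite (trS (sc _)) ιD (ιS (sc _)).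
    by have := ι_ge0 (sc (rt k)); lra.
  have -> : mns on (mns (tr (sc (rt k))) (sc k)) = zr by apply/mns1_eq0.
  rewrite add0 //; split; first by rewrite ιS; lra.
  by rewrite ltNge; apply/negP => /mns_eq0_le.
move=> [/mns_eq0_le h1 /mns_eq0_lt h2]; apply/andP; split; [exact: h1|exact: h2].
Qed.

(** If two roots differed, the smaller one's successor would be at most the larger one; the
    quadratic formula [ι_tr] then orders the triangular numbers against the bounds. *)
Lemma rt_unique p w : ι (tr w) <= ι p < ι (tr (sc w)) -> rt p = w.
Proof.
move=> /andP[h1 h2]; have /andP[h3 h4] := rtP p.
apply: ι_inj; apply: le_anti; apply/andP; split; rewrite leNgt; apply/negP.
  rewrite ι_ltS => h; have e1 := ι_tr (sc w); have e2 := ι_tr (rt p).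
  have g1 := ι_ge0 (sc w); have g2 := ι_ge0 (rt p); nra.
rewrite ι_ltS => h; have e1 := ι_tr (sc (rt p)); have e2 := ι_tr w.
by have g1 := ι_ge0 (sc (rt p)); have g2 := ι_ge0 w; nra.
Qed.

Lemma rt_pr m n : rt (pr m n) = add m n.
Proof.
apply: rt_unique; rewrite /pr trS !ιD ιS ιD.
by have := ι_ge0 m; have := ι_ge0 n; lra.
Qed.

Lemma sn_pr m n : sn (pr m n) = n.
Proof. by rewrite /sn rt_pr /pr addKl. Qed.

Lemma fs_pr m n : fs (pr m n) = m.
Proof. by rewrite /fs sn_pr rt_pr addK. Qed.

(** * Values of rational codes in the ordered field *)

Definition val q : F := (ι (fs (fs q)) - ι (sn (fs q))) / ι (sc (sn q)).

Lemma ιS_gt0 n : 0 < ι (sc n).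
Proof. by rewrite ιS; have := ι_ge0 n; lra. Qed.

Lemma val_rat Γ (a b d : tm Γ N) (ρ : env M Γ) : 0 < ι (eval d ρ) ->
  val (eval (rat a b d) ρ) = (ι (eval a ρ) - ι (eval b ρ)) / ι (eval d ρ).
Proof.
rewrite /rat !evalN /val !(fs_pr, sn_pr).
have [->|[k ->]] := zr_or_sc M_models M_ext (eval d ρ); first by rewrite ι0 ltxx.
by rewrite prdS.
Qed.

Lemma eval_den Γ (q : tm Γ N) (ρ : env M Γ) :
  eval (den q) ρ = sc (sn (eval q ρ)). Proof. by []. Qed.
Lemma eval_pos Γ (q : tm Γ N) (ρ : env M Γ) :
  eval (pos q) ρ = fs (fs (eval q ρ)). Proof. by []. Qed.
Lemma eval_neg Γ (q : tm Γ N) (ρ : env M Γ) :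
  eval (neg q) ρ = sn (fs (eval q ρ)). Proof. by []. Qed.

Definition evalQ := (evalN, eval_den, eval_pos, eval_neg).

Lemma val_qadd Γ (q r : tm Γ N) (ρ : env M Γ) :
  val (eval (qadd q r) ρ) = val (eval q ρ) + val (eval r ρ).
Proof.
have q0 := ιS_gt0 (sn (eval q ρ)); have r0 := ιS_gt0 (sn (eval r ρ)).
rewrite val_rat !evalQ !(ιD, ιM) /val; last exact: mulr_gt0.
by field; rewrite !gt_eqF.
Qed.

Lemma val_qsub Γ (q r : tm Γ N) (ρ : env M Γ) :
  val (eval (qsub q r) ρ) = val (eval q ρ) - val (eval r ρ).
Proof.
have q0 := ιS_gt0 (sn (eval q ρ)); have r0 := ιS_gt0 (sn (eval r ρ)).
rewrite val_rat !evalQ !(ιD, ιM) /val; last exact: mulr_gt0.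
by field; rewrite !gt_eqF.
Qed.

Lemma val_qabs Γ (q : tm Γ N) (ρ : env M Γ) :
  val (eval (qabs q) ρ) = `|val (eval q ρ)|.
Proof.
have q0 := ιS_gt0 (sn (eval q ρ)).
rewrite val_rat !evalQ // ιD ι0 subr0 /val normrM normfV (gtr0_norm q0).
congr (_ / _); move: (fs _) (sn _) => a b.
have [h|/ltW h] := leP (ι b) (ι a).
  by rewrite (ι_mns h) (proj2 (mns_eq0_le _ _) h) ι0 ger0_norm; lra.
by rewrite (ι_mns h) (proj2 (mns_eq0_le _ _) h) ι0 ler0_norm; lra.
Qed.

Lemma val_le q r : (val q <= val r) =
  (ι (fs (fs q)) * ι (sc (sn r)) + ι (sn (fs r)) * ι (sc (sn q)) <=
   ι (fs (fs r)) * ι (sc (sn q)) + ι (sn (fs q)) * ι (sc (sn r))).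
Proof.
have q0 := ιS_gt0 (sn q); have r0 := ιS_gt0 (sn r).
rewrite /val ler_pdivrMr // mulrAC ler_pdivlMr //.
by apply/idP/idP => h; lra.
Qed.

Lemma sat_leN Γ (t u : tm Γ N) (ρ : env M Γ) :
  sat (leN t u) ρ <-> ι (eval t ρ) <= ι (eval u ρ).
Proof. exact: mns_eq0_le. Qed.

Lemma sat_ltN Γ (t u : tm Γ N) (ρ : env M Γ) :
  sat (ltN t u) ρ <-> ι (eval t ρ) < ι (eval u ρ).
Proof. exact: mns_eq0_lt. Qed.

Lemma sat_qle Γ (q r : tm Γ N) (ρ : env M Γ) :
  sat (qle q r) ρ <-> val (eval q ρ) <= val (eval r ρ).
Proof. by rewrite sat_leN !evalQ !(ιD, ιM) val_le. Qed.

Lemma sat_qlt Γ (q r : tm Γ N) (ρ : env M Γ) :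
  sat (qlt q r) ρ <-> val (eval q ρ) < val (eval r ρ).
Proof. by rewrite sat_ltN !evalQ !(ιD, ιM) !ltNge val_le. Qed.

Definition pn n : F := (ι (pw n))^-1.

Lemma ι_pw_gt0 n : 0 < ι (pw n).
Proof.
rewrite -ι0; apply/mns_eq0_lt.
apply: (qf_induction M_models (φ := ltN zero (pow2 v0)) (ρ := enil M)) => //.
  by apply/sat_ltN; rewrite -[eval (pow2 _) _]/(pw zr) pw0 ι1 ι0.
move=> k /sat_ltN h; apply/sat_ltN; move: h.
rewrite -[eval (pow2 _) _]/(pw k) -[eval (pow2 _) (econs (sc k) _)]/(pw (sc k)).
by rewrite pwS ιD ι0; lra.
Qed.

Lemma pn_gt0 n : 0 < pn n.
Proof. by rewrite invr_gt0 ι_pw_gt0. Qed.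

Lemma pn0 : pn zr = 1.
Proof. by rewrite /pn pw0 ι1 invr1. Qed.

Lemma pnS n : pn (sc n) = pn n / 2.
Proof.
have := ι_pw_gt0 n => h; rewrite /pn pwS ιD; field.
by rewrite gt_eqF //=; apply/eqP; lra.
Qed.

Lemma pn_anti m n : ι m <= ι n -> pn n <= pn m.
Proof.
move=> /mns_eq0_le; rewrite mns_eq0 // => -[p <-].
rewrite lef_pV2 ?posrE ?ι_pw_gt0 //; apply/mns_eq0_le.
apply: (qf_induction M_models (φ := leN (pow2 v1) (pow2 (addN v1 v0))) (ρ := env1 m)) => //.
  by apply/sat_leN; rewrite !evalN /= add0.
move=> k /sat_leN h; apply/sat_leN; move: h; rewrite !evalN /= addS // pwS ιD.
by have := ι_pw_gt0 (add m k); lra.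
Qed.

Lemma val_dyadic Γ (c n : tm Γ N) (ρ : env M Γ) :
  val (eval (dyadic c n) ρ) = ι (eval c ρ) * pn (eval n ρ).
Proof. by rewrite val_rat !evalN ?ι_pw_gt0 // ι0 subr0. Qed.

(** * The formulas about reals as inequalities in the field *)

Definition real (x : dom M B) : Prop :=
  forall n m, `|val (x ∙ n) - val (x ∙ add n m)| < pn n.
Definition rltv (x y : dom M B) : Prop :=
  exists n, val (x ∙ n) + 2 * pn n < val (y ∙ n).
Definition in01v (x : dom M B) : Prop :=
  forall n, - (2 * pn n) <= val (x ∙ n) <= 1 + 2 * pn n.
Definition memv (h : dom M (B ⇒ B)) (x : dom M B) : Prop :=
  exists n, 2 * pn n < val (h ∙ x ∙ n).
(** The index [sc n] is the shift built into [rsub]. *)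
Definition ballv (z y : dom M B) (k : dom M N) : Prop :=
  exists n, `|val (z ∙ sc n) - val (y ∙ sc n)| + 2 * pn n < pn k.

Lemma val_dyadic0 Γ (n : tm Γ N) (ρ : env M Γ) : val (eval (dyadic zero n) ρ) = 0.
Proof. by rewrite val_dyadic -[eval zero ρ]/zr ι0 mul0r. Qed.

Lemma val_dyadic1 Γ (n : tm Γ N) (ρ : env M Γ) :
  val (eval (dyadic one n) ρ) = pn (eval n ρ).
Proof. by rewrite val_dyadic -[eval one ρ]/on ι1 mul1r. Qed.

Lemma ι_two Γ (ρ : env M Γ) : ι (eval two ρ) = 2.
Proof. by rewrite -[eval two ρ]/(sc on) ιS ι1. Qed.

Lemma val_dyadic2 Γ (n : tm Γ N) (ρ : env M Γ) :
  val (eval (dyadic two n) ρ) = 2 * pn (eval n ρ).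
Proof. by rewrite val_dyadic (ι_two ρ). Qed.

Lemma sat_isReal Γ (t : tm Γ B) (ρ : env M Γ) : sat (isReal t) ρ <-> real (eval t ρ).
Proof.
rewrite /isReal sat_All; split=> h n; last (rewrite sat_All => m; move: (h n m));
  [move=> m; have := h n; rewrite sat_All => /(_ m)|];
  by rewrite sat_qlt val_qabs val_qsub val_dyadic1 !eval_App !eval_wk.
Qed.

Lemma sat_rlt Γ (t u : tm Γ B) (ρ : env M Γ) :
  sat (rlt t u) ρ <-> rltv (eval t ρ) (eval u ρ).
Proof.
by rewrite /rlt sat_Ex; split=> -[n h]; exists n; move: h;
  rewrite sat_qlt val_qadd val_dyadic2 !eval_App !eval_wk.
Qed.

Lemma eval_rconst Γ (q : tm Γ N) (ρ : env M Γ) n : eval (rconst q) ρ ∙ n = eval q ρ.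
Proof. exact: apK. Qed.

Lemma sat_mem Γ (t : tm Γ B) (h : tm Γ (B ⇒ B)) (ρ : env M Γ) :
  sat (mem t h) ρ <-> memv (eval h ρ) (eval t ρ).
Proof.
by rewrite /mem sat_rlt; split=> -[n e]; exists n; move: e;
  rewrite eval_rconst val_dyadic0 add0r.
Qed.

Lemma sat_inBall Γ (z y : tm Γ B) (k : tm Γ N) (ρ : env M Γ) :
  sat (inBall z y k) ρ <-> ballv (eval z ρ) (eval y ρ) (eval k ρ).
Proof.
have e n : val (eval (rabs (rsub z y)) ρ ∙ n) =
    `|val (eval z ρ ∙ sc n) - val (eval y ρ ∙ sc n)|.
  rewrite /rabs eval_lam // val_qabs eval_App eval_wk /rsub eval_lam //.
  by rewrite val_qsub !eval_App !eval_wk.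
by rewrite /inBall sat_rlt; split=> -[n h]; exists n; move: h;
  rewrite e eval_rconst val_dyadic1.
Qed.

Lemma sat_in01 Γ (t : tm Γ B) (ρ : env M Γ) : sat (in01 t) ρ <-> in01v (eval t ρ).
Proof.
have h0 : sat (rle rzero t) ρ <-> forall n, 0 <= val (eval t ρ ∙ n) + 2 * pn n.
  by rewrite /rle sat_All; split=> h n; have := h n;
    rewrite sat_qle val_qadd val_dyadic2 eval_App eval_wk eval_rconst val_dyadic0
      eval_App eval_wk.
have h1 : sat (rle t rone) ρ <-> forall n, val (eval t ρ ∙ n) <= 1 + 2 * pn n.
  by rewrite /rle sat_All; split=> h n; have := h n;
    rewrite sat_qle val_qadd val_dyadic2 [eval (wk rone ⋅ v0) _]eval_App eval_wk
      eval_rconst val_dyadic1 pn0 eval_App eval_wk.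
rewrite /in01 sat_And h0 h1; split=> [[g g'] n|g].
  by have := g n; have := g' n; lra.
by split=> n; have := g n; lra.
Qed.

Lemma real_le x m n : real x -> ι m <= ι n ->
  - pn m < val (x ∙ m) - val (x ∙ n) < pn m.
Proof.
move=> rx /mns_eq0_le; rewrite mns_eq0 // => -[p <-].
by rewrite -ltr_norml; apply: rx.
Qed.

(** The contrapositive of induction. For a downward closed [φ], as in both uses, the jump found is
    the maximum. *)
Lemma arith_maximal Γ (φ : fm (N :: Γ)) (ρ : env M Γ) b : arith φ ->
  sat φ (econs zr ρ) -> ~ sat φ (econs b ρ) ->
  exists c, sat φ (econs c ρ) /\ ~ sat φ (econs (sc c) ρ).
Proof.
move=> aφ h0 hb; apply: contrapT => h; apply: hb.
apply: (arith_induction M_models M_ext aφ h0) => c hc.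
by apply: contrapT => hc'; apply: h; exists c.
Qed.

Lemma ι_pw_pn k : ι (pw k) * pn k = 1.
Proof. by rewrite mulfV // gt_eqF // ι_pw_gt0. Qed.

Lemma dyadic_approx k q : - (2 * pn k) <= val q <= 1 + 2 * pn k ->
  exists c, ι c <= ι (pw k) /\ `|val q - ι c * pn k| <= 2 * pn k.
Proof.
move=> hq.
(* The disjunct [v0 ≐ zero] covers slightly negative [q], so that zero always qualifies. *)
pose φ : fm [N; N; N] := leN v0 (pow2 v1) ⊓ (v0 ≐ zero ⊔ qle (dyadic v0 v1) v2).
have φP c : sat φ (econs c (env2 k q)) <->
    ι c <= ι (pw k) /\ (c = zr \/ ι c * pn k <= val q).
  by rewrite /φ sat_And sat_Or sat_leN sat_qle val_dyadic.
have p0 := pn_gt0 k; have e1 := ι_pw_pn k.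
have [||//|c [/φP[h1 h2] h3]] := @arith_maximal _ φ (env2 k q) (sc (pw k)).
- by [].
- by apply/φP; rewrite ι0; split; [exact: ι_ge0|left].
- by move=> /φP[+ _]; rewrite ιS; lra.
exists c; split=> //; rewrite ler_norml.
have h4 : - (2 * pn k) <= val q - ι c * pn k.
  by case: h2 => [->|]; [rewrite ι0|]; lra.
apply/andP; split=> //; rewrite leNgt; apply/negP => h5; apply: h3; apply/φP.
(* A larger error would let [sc c] qualify as well: it still lies below [q], and [c] is not yet
   [2^k] because [q] exceeds 1 by at most two units of [2^-k]. *)
have h6 : ι (sc c) * pn k <= val q by rewrite ιS; lra.
split; last by right.
rewrite -ι_ltS ltNge; apply/negP => h7.
have : ι (pw k) * pn k <= ι c * pn k by rewrite ler_pM2r.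
by lra.
Qed.

(** At a late common index the approximations are ordered as [a], [z], [b], with [a] and [b] less
    than [2^-k] apart. Returning to index [k] costs another [2^-k] for each of [a] and [z]. *)
Lemma between_near a b z k : real a -> real b -> real z ->
  ballv a b k -> rltv a z -> rltv z b ->
  `|val (z ∙ k) - val (a ∙ k)| <= 3 * pn k.
Proof.
move=> ra rb rz [m3 h3] [m1 h1] [m2 h2].
(* A sum dominates all four indices without a maximum operation. *)
pose n := add (add m1 m2) (add (sc m3) k).
have [g1 [g2 [g3 g4]]] :
    [/\ ι m1 <= ι n, ι m2 <= ι n & ι (sc m3) <= ι n /\ ι k <= ι n].
  have := ι_ge0 m1; have := ι_ge0 m2; have := ι_ge0 (sc m3); have := ι_ge0 k.
  by rewrite /n !ιD; split; [| |split]; lra.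
have := real_le ra g1; have := real_le rz g1.
have := real_le rb g2; have := real_le rz g2.
have := real_le ra g3; have := real_le rb g3.
have := real_le ra g4; have := real_le rz g4.
have := pnS m3; have := pn_gt0 m3.
have : `|val (a ∙ sc m3) - val (b ∙ sc m3)| < pn k - 2 * pn m3 by lra.
rewrite ltr_norml ler_norml.
by lra.
Qed.

(** * Points outside the open sets, and their coding *)

Definition eight {Γ} : tm Γ N := mulN two (mulN two two).

(** The endpoints [a] and [b] are forgotten; only the center [c / 2^k] remains. [dyadic_approx] and
    [between_near] contribute errors of 2 and 3 units of [2^-k], for which 8 leaves room. *)
Definition good_fm Γ (z : tm Γ B) (n k c : tm Γ N) (O : tm Γ (N ⇒ B ⇒ B)) : fm Γ :=
  isReal z ⊓ Neg (mem z (O ⋅ n)) ⊓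
  qle (qabs (qsub (z ⋅ k) (dyadic c k))) (dyadic eight k).

Definition good (z : dom M B) (n k c : dom M N) (O : dom M (N ⇒ B ⇒ B)) : Prop :=
  [/\ real z, ~ memv (O ∙ n) z & `|val (z ∙ k) - ι c * pn k| <= 8 * pn k].

Lemma sat_good_fm Γ z n k c O (ρ : env M Γ) : sat (good_fm z n k c O) ρ <->
  good (eval z ρ) (eval n ρ) (eval k ρ) (eval c ρ) (eval O ρ).
Proof.
have e : 2 * (2 * 2) = 8 :> F by ring.
rewrite /good_fm !sat_And sat_Neg sat_isReal sat_mem sat_qle val_qabs val_qsub.
rewrite !val_dyadic /eight !evalN !ιM !(ι_two ρ) e !eval_App.
by split=> [[? []]|[]].
Qed.

(** One function carries both data: every value has [c] as first component, and the second component
    at argument [pr n a] is entry [a] of the [n]-th point. *)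
Definition code_of (c : dom M N) (Z : dom M (N ⇒ B)) : dom M B :=
  eval (lam (pairN v1 (v2 ⋅ fstN v0 ⋅ sndN v0))) (econs c (econs Z (enil M))).
Definition point_tm Γ (f : tm Γ B) (n : tm Γ N) : tm Γ B :=
  lam (sndN (wk f ⋅ pairN (wk n) v0)).
Definition point (f : dom M B) (n : dom M N) : dom M B :=
  eval (point_tm v0 v1) (econs f (econs n (enil M))).
Definition center (f : dom M B) : dom M N := fs (f ∙ zr).

Lemma pointE f n a : point f n ∙ a = sn (f ∙ pr n a).
Proof. by rewrite /point /point_tm eval_lam. Qed.

Lemma code_ofE c Z a : code_of c Z ∙ a = pr c (Z ∙ fs a ∙ sn a).
Proof. by rewrite /code_of eval_lam. Qed.

Lemma eval_point_tm Γ (f : tm Γ B) (n : tm Γ N) (ρ : env M Γ) :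
  eval (point_tm f n) ρ = point (eval f ρ) (eval n ρ).
Proof.
apply: M_ext => a; rewrite pointE /point_tm eval_lam //.
rewrite -[LHS]/(sn (eval (wk f) (econs a ρ) ∙ pr (eval (wk n) (econs a ρ)) a)).
by rewrite !eval_wk.
Qed.

Lemma center_code c Z : center (code_of c Z) = c.
Proof. by rewrite /center code_ofE fs_pr. Qed.

Lemma point_code c Z n : point (code_of c Z) n = Z ∙ n.
Proof. by apply: M_ext => a; rewrite pointE code_ofE sn_pr fs_pr sn_pr. Qed.

(** * Existence of a Lebesgue number for a cover in the model *)

Section LebesgueNumber.
Variable O : dom M (N ⇒ B ⇒ B).
Hypothesis O_open : forall n x, real x -> memv (O ∙ n) x ->
  exists k, forall z, real z -> ballv z x k -> memv (O ∙ n) z.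
Hypothesis O_cover : forall x, real x -> in01v x -> exists n, memv (O ∙ n) x.

Definition lebesgue_number k := forall a b, real a -> real b -> in01v a -> in01v b ->
  ballv a b k -> exists n, forall z, real z -> rltv a z -> rltv z b -> memv (O ∙ n) z.

Definition bad_code (f : dom M B) (k : dom M N) : Prop :=
  ι (center f) <= ι (pw k) /\ forall n, good (point f n) n k (center f) O.

(** The real endpoints are obtained by classical logic outside the model. Only the choice of the
    points over [n] is made inside, and its formula is arithmetical. *)
Lemma bad_code_ex k : ~ lebesgue_number k -> exists f, bad_code f k.
Proof.
move=> h; have [a [b [[ra rb a01 bab] hz]]] : exists a b,
    [/\ real a, real b, in01v a & ballv a b k] /\
    forall n, exists z, [/\ real z, rltv a z, rltv z b & ~ memv (O ∙ n) z].
  apply: contrapT => h'; apply: h => a b ra rb a01 b01 bab.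
  apply: contrapT => h; apply: h'; exists a, b; split=> // n.
  apply: contrapT => h'; apply: h; exists n => z rz az zb.
  by apply: contrapT => hz; apply: h'; exists z.
have [c [c_le c_near]] := dyadic_approx (a01 k).
pose ρ : env M [N; N; N ⇒ B ⇒ B] := econs k (econs c (econs O (enil M))).
pose φ : fm [B; N; N; N; N ⇒ B ⇒ B] := good_fm v0 v1 v2 v3 v4.
have [||Z ZP] := arith_choice M_models M_ext (φ := φ) (ρ := ρ).
- by rewrite /φ /=.
- move=> n; have [z [rz az zb nz]] := hz n; exists z; apply/sat_good_fm; split=> //.
  have := between_near ra rb rz bab az zb; move: c_near.
  rewrite -[eval v2 _]/k -[eval v3 _]/c -[eval v0 _]/z !ler_norml.
  by have := pn_gt0 k; lra.
exists (code_of c Z); split; first by rewrite center_code.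
by move=> n; have := ZP n; rewrite sat_good_fm center_code point_code.
Qed.

Section NoLebesgueNumber.
Hypothesis no_lebesgue_number : forall k, ~ lebesgue_number k.

Lemma bad_codes_ex : exists G : dom M (N ⇒ B), forall k, bad_code (G ∙ k) k.
Proof.
pose ρ : env M [N ⇒ B ⇒ B] := econs O (enil M).
pose φ : fm [B; N; N ⇒ B ⇒ B] :=
  leN (fstN (v0 ⋅ zero)) (pow2 v1) ⊓
  ∀[N] good_fm (point_tm v1 v0) v0 v2 (fstN (v1 ⋅ zero)) v3.
have φP f k : sat φ (econs f (econs k ρ)) <-> bad_code f k.
  rewrite /φ sat_And sat_leN sat_All.
  by split=> -[h1 h2]; split=> // n; have := h2 n; rewrite sat_good_fm eval_point_tm.
have [||G GP] := arith_choice M_models M_ext (φ := φ) (ρ := ρ).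
- by rewrite /φ /=.
- by move=> k; have [f fP] := bad_code_ex (no_lebesgue_number (k := k)); exists f; apply/φP.
by exists G => k; apply/φP.
Qed.

Variable G : dom M (N ⇒ B).
Hypothesis GP : forall k, bad_code (G ∙ k) k.

(** * The limit superior of the centers *)

Definition radix k : F := ι (center (G ∙ k)) * pn k.

Lemma radix_le1 k : radix k <= 1.
Proof. by rewrite -(ι_pw_pn k) ler_pM2r ?pn_gt0 //; have [] := GP k. Qed.

Lemma radix_ge0 k : 0 <= radix k.
Proof. by rewrite mulr_ge0 // ltW // pn_gt0. Qed.

Definition frequently (d n : dom M N) : Prop :=
  forall K, exists k, ι K <= ι k /\ ι d * pn n <= radix k.

Definition frequently_fm Γ (d n : tm Γ N) (g : tm Γ (N ⇒ B)) : fm Γ :=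
  ∀[N] ∃[N] leN v1 v0 ⊓
    qle (dyadic (wk (wk d)) (wk (wk n))) (dyadic (fstN (wk (wk g) ⋅ v0 ⋅ zero)) v0).

Lemma sat_frequently_fm Γ (d n : tm Γ N) (g : tm Γ (N ⇒ B)) (ρ : env M Γ) :
  eval g ρ = G ->
  (sat (frequently_fm d n g) ρ <-> frequently (eval d ρ) (eval n ρ)).
Proof.
move=> eG; rewrite /frequently_fm sat_All.
split=> h K; have := h K; rewrite ?sat_Ex => -[k hk]; exists k; move: hk;
  by rewrite sat_And sat_leN sat_qle !val_dyadic !evalN !eval_App !eval_wk eG.
Qed.

(** Choice returns elements of Baire space, so the number selected for [n] is stored as a function
    and read off at [zero]. *)
Lemma limsup_ex : exists D : dom M (N ⇒ B), forall n,
  frequently (D ∙ n ∙ zr) n /\ ~ frequently (sc (D ∙ n ∙ zr)) n.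
Proof.
pose ρ : env M [N ⇒ B] := econs G (enil M).
pose φ : fm [B; N; N ⇒ B] :=
  frequently_fm (v0 ⋅ zero) v1 v2 ⊓ Neg (frequently_fm (succ (v0 ⋅ zero)) v1 v2).
have φP f n : sat φ (econs f (econs n ρ)) <->
    frequently (f ∙ zr) n /\ ~ frequently (sc (f ∙ zr)) n.
  by rewrite /φ sat_And sat_Neg !sat_frequently_fm.
have [||D DP] := arith_choice M_models M_ext (φ := φ) (ρ := ρ).
- by rewrite /φ /=.
- move=> n; pose ψ : fm [N; N; N ⇒ B] := frequently_fm v0 v1 v2.
  have ψP d : sat ψ (econs d (econs n ρ)) <-> frequently d n.
    by rewrite /ψ sat_frequently_fm.
  (* The bound [sc (pw n)] fails because its quotient by [2^n] exceeds 1, while every [radix] is at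
     most 1. *)
  have [||//|d [/ψP h1 h2]] := @arith_maximal _ ψ (econs n ρ) (sc (pw n)).
  + by rewrite /ψ /=.
  + by apply/ψP => K; exists K; rewrite lexx ι0 mul0r radix_ge0.
  + move=> /ψP/(_ zr)[k [_]]; rewrite ιS mulrDl ι_pw_pn.
    by have := radix_le1 k; have := pn_gt0 n; lra.
  exists (eval (rconst v0) (env1 d)); apply/φP; rewrite eval_rconst.
  by split=> // /ψP.
by exists D => n; apply/φP.
Qed.

Variable D : dom M (N ⇒ B).
Hypothesis DP : forall n, frequently (D ∙ n ∙ zr) n /\ ~ frequently (sc (D ∙ n ∙ zr)) n.

Definition lower n : F := ι (D ∙ n ∙ zr) * pn n.

Lemma lower_freq n K : exists k, ι K <= ι k /\ lower n <= radix k.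
Proof. by have [h _] := DP n; apply: h. Qed.

Lemma lower_ev n : exists K, forall k, ι K <= ι k -> radix k < lower n + pn n.
Proof.
have [_ h] := DP n; apply: contrapT => h'; apply: h => K.
apply: contrapT => h; apply: h'; exists K => k Kk.
rewrite ltNge; apply/negP => hk; apply: h; exists k; split=> //.
by move: hk; rewrite /lower ιS mulrDl mul1r.
Qed.

(** One late [k] serves both sides: its [radix] is at least [lower m], which recurs without end, and
    below [lower n + pn n], which holds eventually. This yields a Cauchy property without a limit in
    [F]. *)
Lemma lower_lt m n : lower m < lower n + pn n.
Proof.
have [K KP] := lower_ev n; have [k [Kk h]] := lower_freq m K.
by have := KP k Kk; lra.
Qed.

Definition cluster : dom M B :=
  eval (lam (dyadic (v1 ⋅ succ v0 ⋅ zero) (succ v0))) (econs D (enil M)).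

Lemma val_cluster n : val (cluster ∙ n) = lower (sc n).
Proof. by rewrite /cluster eval_lam // val_dyadic. Qed.

Lemma cluster_real : real cluster.
Proof.
move=> n m; rewrite !val_cluster ltr_norml.
have := lower_lt (sc n) (sc (add n m)); have := lower_lt (sc (add n m)) (sc n).
have : pn (sc (add n m)) <= pn (sc n).
  by apply: pn_anti; rewrite !ιS ιD; have := ι_ge0 m; lra.
by rewrite !pnS; have := pn_gt0 n; lra.
Qed.

Lemma cluster_in01 : in01v cluster.
Proof.
move=> n; rewrite val_cluster.
have [k [_ h]] := lower_freq (sc n) zr; have := radix_le1 k.
have : 0 <= lower (sc n) by rewrite mulr_ge0 // ltW // pn_gt0.
by have := pn_gt0 n; lra.
Qed.

Lemma no_lebesgue_number_absurd : False.
Proof.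
(* The index [n] is fixed here, before [k]: the codes in [G] already hold a point outside this [O_n]
   for every [k]. *)
have [n nP] := O_cover cluster_real cluster_in01.
have [m mP] := O_open cluster_real nP.
(* Four halvings provide 16 units of [2^-i] inside the radius [2^-m], enough for the errors added up
   below. *)
pose i := sc (sc (sc (sc m))).
have pi : pn m = 16 * pn i by rewrite /i !pnS; field.
(* Taking [k] beyond [K + i] makes the upper bound on [radix k] apply and also gives
   [2^-k <= 2^-i]. *)
have [K KP] := lower_ev i; have [k [Kk hk]] := lower_freq i (add K i).
have gK := ι_ge0 K; have gi := ι_ge0 i.
have ik : ι i <= ι k by move: Kk; rewrite ιD; lra.
have h1 : radix k < lower i + pn i by apply: KP; move: Kk; rewrite ιD; lra.
have [_ /(_ n)[rz nz dz]] := GP k.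
apply: nz; apply: mP => //; exists k.
rewrite val_cluster pi.
have h4 := lower_lt i (sc (sc k)); have h5 := lower_lt (sc (sc k)) i.
have h6 : pn (sc (sc k)) <= pn i by apply/pn_anti/(le_trans ik); rewrite !ιS; lra.
have h7 := pn_anti ik; have h8 := pn_gt0 i; have h9 := pn_gt0 k.
move: dz; rewrite -/(radix k) ler_norml => /andP[h10 h11].
(* The error is below 11 units of [2^-i]: 1 from [z] at [sc k] to [z] at [k], 8 to the center, 1 to
   [lower i], 1 to the cluster point. The ball condition adds at most 2, so proving 13 keeps the
   total below 16. *)
suff : `|val (point (G ∙ k) n ∙ sc k) - lower (sc (sc k))| < 13 * pn i by lra.
have h12 : ι k <= ι (sc k) by rewrite ιS; lra.
have /andP[h13 h14] := real_le rz h12.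
by rewrite ltr_norml; lra.
Qed.

End NoLebesgueNumber.

Lemma lebesgue_number_ex : exists k, lebesgue_number k.
Proof.
apply: contrapT => h.
have h' k : ~ lebesgue_number k by move=> hk; apply: h; exists k.
have [G GP] := bad_codes_ex h'; have [D DP] := limsup_ex GP.
exact: (no_lebesgue_number_absurd GP DP).
Qed.

End LebesgueNumber.

Lemma lebesgue_sat : sat
    (∀[N ⇒ B ⇒ B]
       (∀[N] isOpen (v1 ⋅ v0)) ⊃
       (∀ℝ in01 v0 ⊃ ∃[N] mem v1 (v2 ⋅ v0)) ⊃
       ∃[N] ∀ℝ ∀ℝ
         in01 v1 ⊃ in01 v0 ⊃ inBall v1 v0 v2 ⊃
         ∃[N] ∀ℝ
           rlt v3 v0 ⊃ rlt v0 v2 ⊃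
           mem v0 (v5 ⋅ v1)) (enil M).
Proof.
apply/sat_All => O; apply/sat_Imp => hopen; apply/sat_Imp => hcover.
have O_open n x : real x -> memv (O ∙ n) x ->
    exists k, forall z, real z -> ballv z x k -> memv (O ∙ n) z.
  move=> rx mx; move/sat_All/(_ n): hopen => /sat_And[_] /sat_All/(_ x)/sat_Imp.
  rewrite sat_isReal sat_Imp sat_mem sat_Ex => /(_ rx mx)[k hk].
  exists k => z rz bz; move/sat_All/(_ z)/sat_Imp: hk.
  by rewrite sat_isReal sat_Imp sat_inBall sat_mem; apply.
have O_cover x : real x -> in01v x -> exists n, memv (O ∙ n) x.
  move=> rx x01; move/sat_All/(_ x)/sat_Imp: hcover.
  rewrite sat_isReal sat_Imp sat_in01 sat_Ex => /(_ rx x01)[n /sat_mem hn].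
  by exists n.
have [k kP] := lebesgue_number_ex O_open O_cover.
apply/sat_Ex; exists k.
apply/sat_All => a; apply/sat_Imp => /sat_isReal ra.
apply/sat_All => b; apply/sat_Imp => /sat_isReal rb.
apply/sat_Imp => /sat_in01 a01; apply/sat_Imp => /sat_in01 b01.
apply/sat_Imp => /sat_inBall bab; apply/sat_Ex.
have [n nP] := kP a b ra rb a01 b01 bab; exists n.
apply/sat_All => z; apply/sat_Imp => /sat_isReal rz.
apply/sat_Imp => /sat_rlt az; apply/sat_Imp => /sat_rlt zb.
by apply/sat_mem; apply: nP.
Qed.

End Reals.

Theorem theorem2p18 :
  proves ACA0w_QFAC01
    (∀[N ⇒ B ⇒ B]
       (∀[N] isOpen (v1 ⋅ v0)) ⊃
       (∀ℝ in01 v0 ⊃ ∃[N] mem v1 (v2 ⋅ v0)) ⊃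
       ∃[N] ∀ℝ ∀ℝ
         in01 v1 ⊃ in01 v0 ⊃ inBall v1 v0 v2 ⊃
         ∃[N] ∀ℝ
           rlt v3 v0 ⊃ rlt v0 v2 ⊃
           mem v0 (v5 ⋅ v1)).
Proof.
apply: (extensional_completeness ACA0w_QFAC01_sub).
  by move=> Γ ψ h; do 2!constructor.
move=> M M_models M_ext.
have [F [ι [ιD ιM ι0 ι1 [ι_ge0 ι_inj]]]] := nat_embedding M_models M_ext.
exact: (lebesgue_sat M_models M_ext ιD ιM ι0 ι1 ι_ge0 ι_inj).
Qed.
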